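(* Let $(M,\phi_\alpha,\xi_\alpha,\eta_\alpha,g)$, $\alpha\in\{1,2,3\}$, be a 3-quasi-Sasakian manifold of rank $4l+3$, and let $c$ be the constant such that $[\xi_\alpha,\xi_\beta]=c\,\xi_\gamma$ for every even permutation $(\alpha,\beta,\gamma)$ of $\{1,2,3\}$. Then for any unit horizontal vector field $X\in\Gamma(\mathcal{H})$ the $\phi_\alpha$-sectional curvatures satisfy $$H_{1}(X) + H_{2}(X) + H_{3}(X) = \frac{3c^2}{4}\,g\bigl(X_{\mathcal{E}^{4l}},X_{\mathcal{E}^{4l}}\bigr)^2,$$ where $X_{\mathcal{E}^{4l}}$ denotes the orthogonal projection of $X$ onto the distribution $\mathcal{E}^{4l}$. In particular, $H_1(X)+H_2(X)+H_3(X)=\frac{3c^2}{4}$ for any unit $X\in\Gamma(\mathcal{E}^{4l})$, and $H_1(X)+H_2(X)+H_3(X)=0$ for any unit $X\in\Gamma(\mathcal{E}^{4m})$.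
   Context: All manifolds are smooth and connected. An almost contact metric structure $(\phi,\xi,\eta,g)$ on $M$ consists of a $(1,1)$-tensor field $\phi$, a vector field $\xi$, a 1-form $\eta$ and a Riemannian metric $g$ with $\phi^2=-I+\eta\otimes\xi$, $\eta(\xi)=1$, $g(\phi X,\phi Y)=g(X,Y)-\eta(X)\eta(Y)$. Convention: $d\eta(X,Y)=X(\eta(Y))-Y(\eta(X))-\eta([X,Y])$. The structure is normal if $[\phi,\phi]+d\eta\otimes\xi=0$, where $[\phi,\phi]$ is the Nijenhuis torsion. Put $\Phi(X,Y)=g(X,\phi Y)$. The structure is quasi-Sasakian if it is normal and $d\Phi=0$. A quasi-Sasakian manifold has rank $2p+1$ if $\eta\wedge(d\eta)^p\neq0$ and $(d\eta)^{p+1}=0$ on $M$. A 3-quasi-Sasakian manifold is a manifold of dimension $4n+3$ with three quasi-Sasakian structures $(\phi_\alpha,\xi_\alpha,\eta_\alpha,g)$, $\alpha\in\{1,2,3\}$, with the same metric $g$, such that for every even permutation $(\alpha,\beta,\gamma)$ of $\{1,2,3\}$: $\phi_\gamma=\phi_\alpha\phi_\beta-\eta_\beta\otimes\xi_\alpha=-\phi_\beta\phi_\alpha+\eta_\alpha\otimes\xi_\beta$, $\xi_\gamma=\phi_\alpha\xi_\beta=-\phi_\beta\xi_\alpha$, $\eta_\gamma=\eta_\alpha\circ\phi_\beta=-\eta_\beta\circ\phi_\alpha$. It is known that there is a constant $c\in\mathbb{R}$ with $[\xi_\alpha,\xi_\beta]=c\,\xi_\gamma$ for every even permutation; that $\eta_1,\eta_2,\eta_3$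 have the same rank (the rank of $M$); and that the rank is either $1$ (exactly when $c=0$) or $4l+3$ for some $l\le n$. Let $\mathcal{H}=\bigcap_{\alpha}\ker\eta_\alpha$ be the horizontal distribution and $\mathcal{V}=\langle\xi_1,\xi_2,\xi_3\rangle$. For rank $4l+3$, with $m=n-l$, put $\mathcal{E}^{4m}=\{X\in\mathcal{H} : i_Xd\eta_\alpha=0 \text{ for } \alpha=1,2,3\}$, $\mathcal{E}^{4l+3}=(\mathcal{E}^{4m})^\perp$, and let $\mathcal{E}^{4l}$ be the orthogonal complement of $\mathcal{V}$ in $\mathcal{E}^{4l+3}$. $\nabla$ is the Levi-Civita connection of $g$ and $R_{XY}=\nabla_X\nabla_Y-\nabla_Y\nabla_X-\nabla_{[X,Y]}$. For a unit vector field $X$ orthogonal to $\xi_\alpha$, the $\phi_\alpha$-sectional curvature is $H_\alpha(X)=K(X,\phi_\alpha X)=g(R_{X\,\phi_\alpha X}\phi_\alpha X,X)$. *)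

(* Defs.v *)
From HB Require Import structures.
From mathcomp Require Import all_boot all_order all_algebra all_fingroup.
From mathcomp Require Import all_classical all_reals all_analysis.
Set Implicit Arguments.
Unset Strict Implicit.
Unset Printing Implicit Defensive.
Import Order.TTheory GRing.Theory Num.Theory.
Import numFieldNormedType.Exports.
Local Open Scope classical_set_scope.
Local Open Scope ring_scope.

Section Smooth.
Context {R : realType}.

(* [Ck k U f]: the iterated directional derivatives of [f] of order at most [k]
   exist and are continuous at every point of the open set [U].  In finite
   dimension this is the usual notion of a C^k map. *)
Fixpoint Ck {V W : normedModType R} (k : nat) (U : set V) (f : V -> W) : Prop :=
  (forall x, U x -> {for x, continuous f}) /\
  if k is k'.+1 then
    (forall x v, U x -> derivable f x v) /\ (forall v, Ck k' U ('D_v f))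
  else True.

Definition smooth_on {V W : normedModType R} (U : set V) (f : V -> W) : Prop :=
  forall k, Ck k U f.

Lemma Ck_continuous (V W : normedModType R) k (U : set V) (f : V -> W) :
  Ck k U f -> forall x, U x -> {for x, continuous f}.
Proof. by case: k => [|k] []. Qed.

Lemma Ck_pred (V W : normedModType R) k (U : set V) (f : V -> W) :
  Ck k.+1 U f -> Ck k U f.
Proof.
elim: k f => [|k IH] f [fc [fd fD]]; first by split.
by split => //; split => // v; exact: IH.
Qed.

Lemma near_continuous (V W : normedModType R) (f g : V -> W) (x : V) :
  {near x, f =1 g} -> {for x, continuous f} -> {for x, continuous g}.
Proof.
move=> fg fc; rewrite /prop_for /continuous_at -(nbhs_singleton fg).
exact: cvg_trans (near_eq_cvg fg) fc.
Qed.

Lemma Ck_ext (V W : normedModType R) k (U : set V) (f g : V -> W) :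
  open U -> (forall x, U x -> f x = g x) -> Ck k U f -> Ck k U g.
Proof.
move=> oU; elim: k f g => [|k IH] f g fg fk.
all: have nfg x : U x -> {near x, f =1 g} by
  move=> Ux; apply: filterS (open_nbhs_nbhs (conj oU Ux)).
all: have gc x : U x -> {for x, continuous g} by
  move=> Ux; apply: near_continuous (nfg _ Ux) _; exact: (Ck_continuous fk).
- by split.
- split => //; case: fk => _ [fd fD]; split => [x v Ux|v].
    exact: near_eq_derivable (nfg _ Ux) (fd _ _ Ux).
  by apply: IH (fD v) => x Ux; apply/near_eq_derive/nfg.
Qed.

Lemma Ck_cst (V W : normedModType R) k (U : set V) (a : W) :
  Ck k U (cst a : V -> W).
Proof.
elim: k a => [|k IH] a /=; split => //; try by move=> x _; exact: cst_continuous.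
split => [x v _|v]; first exact: derivable_cst.
rewrite (_ : 'D_v _ = cst 0); first exact: IH.
by apply/funext => x; exact: derive_cst.
Qed.

Lemma Ck_add (V W : normedModType R) k (U : set V) (f g : V -> W) : open U ->
  Ck k U f -> Ck k U g -> Ck k U (f + g).
Proof.
move=> oU; elim: k f g => [|k IH] f g /= [fc fk] [gc gk].
all: split; first by move=> x Ux; apply: continuousD; [exact: fc|exact: gc].
- by [].
- case: fk gk => [fd fD] [gd gD]; split => [x v Ux|v].
    by apply: derivableD; [exact: fd|exact: gd].
  apply: (Ck_ext oU _ (IH _ _ (fD v) (gD v))) => x Ux.
  by rewrite deriveD//; [exact: fd|exact: gd].
Qed.

Lemma Ck_mul (V : normedModType R) k (U : set V) (f g : V -> R) : open U ->
  Ck k U f -> Ck k U g -> Ck k U (f * g).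
Proof.
move=> oU; elim: k f g => [|k IH] f g fk gk.
all: have fgc x : U x -> {for x, continuous (f * g)}.
1,3: by move=> Ux; apply: continuousM;
  [exact: (Ck_continuous fk)|exact: (Ck_continuous gk)].
- by split.
- split => //; case: (fk) (gk) => [_ [fd fD]] [_ [gd gD]].
  split => [x v Ux|v].
    by apply: derivableM; [exact: fd|exact: gd].
  apply: (Ck_ext oU _ (Ck_add oU (IH _ _ (Ck_pred fk) (gD v))
                               (IH _ _ (Ck_pred gk) (fD v)))) => x Ux.
  by rewrite deriveM//; [exact: fd|exact: gd].
Qed.

End Smooth.

Record chart (R : realType) (d : nat) (T : topologicalType) := Chart {
  chart_dom : set T;
  chart_img : set 'rV[R]_d;
  chart_map : T -> 'rV[R]_d;
  chart_inv : 'rV[R]_d -> T;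
  chart_dom_open : open chart_dom;
  chart_img_open : open chart_img;
  chart_mapK : forall x, chart_dom x ->
    chart_img (chart_map x) /\ chart_inv (chart_map x) = x;
  chart_invK : forall y, chart_img y ->
    chart_dom (chart_inv y) /\ chart_map (chart_inv y) = y;
  chart_map_continuous :
    forall x, chart_dom x -> {for x, continuous chart_map};
  chart_inv_continuous :
    forall y, chart_img y -> {for y, continuous chart_inv}
}.

(* The atlas need not be maximal: all notions below depend only on the
   maximal atlas that it generates. *)
Record manifold (R : realType) (d : nat) := Manifold {
  carrier :> topologicalType;
  manifold_hausdorff : hausdorff_space carrier;
  manifold_second_countable : @second_countable carrier;
  manifold_connected : connected [set: carrier];
  atlas : set (chart R d carrier);
  atlas_cover : forall x : carrier, exists2 k, atlas k & chart_dom k x;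
  atlas_compat : forall k1 k2, atlas k1 -> atlas k2 ->
    smooth_on (chart_img k1 `&` chart_inv k1 @^-1` chart_dom k2)
              (chart_map k2 \o chart_inv k1)
}.

Section SmoothFunctions.
Context {R : realType} {d : nat} (M : manifold R d).

Definition smooth_pred : {pred M -> R} := fun f =>
  `[< forall k, atlas k -> smooth_on (chart_img k) (f \o chart_inv k) >].

Lemma smooth_pred_subring_closed : subring_closed smooth_pred.
Proof.
have smoothM f g : f \in smooth_pred -> g \in smooth_pred ->
    f * g \in smooth_pred.
  move=> /asboolP sf /asboolP sg; apply/asboolP => k ak n.
  by apply: Ck_mul; [exact: chart_img_open|exact: sf|exact: sg].
have smooth_cst (a : R) : cst a \in smooth_pred.
  by apply/asboolP => k _ n; exact: Ck_cst.
split => // [|f g sf sg]; first exact: (smooth_cst 1).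
rewrite -[g]mul1r -mulNr; have := smoothM _ _ (smooth_cst (-1)) sg.
move: sf => /asboolP sf /asboolP sg'; apply/asboolP => k ak n.
rewrite (_ : _ \o _ = (f \o chart_inv k) + ((cst (-1) * g) \o chart_inv k))//.
by apply: Ck_add; [exact: chart_img_open|exact: sf|exact: sg'].
Qed.

Record smooth_fun := SmoothFun {
  sfun_val :> M -> R;
  _ : sfun_val \in smooth_pred }.

HB.instance Definition _ := [isSub for sfun_val].
HB.instance Definition _ := [Choice of smooth_fun by <:].
HB.instance Definition _ := GRing.SubChoice_isSubComPzRing.Build _ smooth_pred
  smooth_fun smooth_pred_subring_closed.

Lemma smooth_cst_subproof (a : R) : (cst a : M -> R) \in smooth_pred.
Proof. by apply/asboolP => k _ n; exact: Ck_cst. Qed.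

Definition smooth_cst (a : R) : smooth_fun :=
  SmoothFun (smooth_cst_subproof a).

End SmoothFunctions.

Section VectorFields.
Context {R : realType} {d : nat} (M : manifold R d).
Local Notation C := (smooth_fun M).

Definition derivation_pred : {pred C -> C^o} := fun D =>
  `[< (forall (a : R) (f h : C),
         D (smooth_cst M a * f + h) = smooth_cst M a * D f + D h) /\
      (forall f h : C, D (f * h) = D f * h + f * D h) >].

Lemma derivation_pred_submod_closed : submod_closed derivation_pred.
Proof.
split.
  by apply/asboolP; split => *; rewrite /= ?mulr0 ?mul0r addr0.
move=> u D E /asboolP[Dl DM] /asboolP[El EM]; apply/asboolP.
have DEE f : (u *: D + E) f = u * D f + E f by [].
split => [a f h|f h]; rewrite !DEE.
  by rewrite Dl El !mulrDr [in LHS]mulrCA addrACA.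
by rewrite DM EM !mulrDr mulrDl !mulrA [f * u]mulrC addrACA.
Qed.

HB.instance Definition _ :=
  GRing.isSubmodClosed.Build _ _ derivation_pred derivation_pred_submod_closed.

Record vfield := VField { vf_val :> C -> C^o; _ : vf_val \in derivation_pred }.

HB.instance Definition _ := [isSub for vf_val].
HB.instance Definition _ := [Choice of vfield by <:].
HB.instance Definition _ := [SubChoice_isSubLmodule of vfield by <:].

Lemma lie_bracket_subproof (X Y : vfield) :
  ((fun f => X (Y f) - Y (X f)) : C -> C^o) \in derivation_pred.
Proof.
have scst1 : smooth_cst M 1 = 1 by exact/val_inj.
have addE (Z : C -> C) :
    (forall (a : R) (f h : C),
       Z (smooth_cst M a * f + h) = smooth_cst M a * Z f + Z h) ->
    {morph Z : f h / f + h}.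
  by move=> Zl f h; rewrite -[f]mul1r -scst1 Zl scst1 !mul1r.
have /asboolP[Xl XM] := valP X; have /asboolP[Yl YM] := valP Y; apply/asboolP.
split => [a f h|f h].
  by rewrite Xl Yl Xl Yl mulrBr opprD addrACA.
rewrite XM YM (addE _ Xl) (addE _ Yl) !XM !YM.
rewrite [Y (X f) * h + _ + _]addrACA opprD addrACA !opprD.
rewrite [X in X + _ = _]addrACA subrr addr0.
rewrite [X in _ + X = _]addrACA subrr add0r.
by rewrite mulrBl mulrBr.
Qed.

Definition lie_bracket (X Y : vfield) : vfield :=
  VField (lie_bracket_subproof X Y).




End VectorFields.

(* (1,1)-tensor fields and 1-forms are the maps on vector fields that are linear
   over smooth functions. *)
Notation endo M := {linear vfield M -> vfield M}.
Notation one_form M := {linear vfield M -> smooth_fun M | *%R}.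

(* The values [X p] of the vector fields [X] exhaust the tangent space at [p],
   so a vector field stands for its value at [p] whenever a notion at [p] is
   expressed below through the values at [p] of tensor fields. *)
Definition same_at {R : realType} {d : nat} (M : manifold R d) (p : M)
    (X Y : vfield M) : Prop :=
  forall f : smooth_fun M, (X f : smooth_fun M) p = (Y f : smooth_fun M) p.

Record metric (R : realType) (d : nat) (M : manifold R d) := Metric {
  metric_val :> vfield M -> vfield M -> smooth_fun M;
  metric_linear : forall (X Y Z : vfield M) (f : smooth_fun M),
    metric_val (f *: X + Y) Z = f * metric_val X Z + metric_val Y Z;
  metric_sym : forall X Y, metric_val X Y = metric_val Y X;
  metric_pos : forall (X : vfield M) (p : M),
    ~ same_at p X 0 -> 0 < metric_val X X p
}.

Section Geometry.
Context {R : realType} {d : nat} {M : manifold R d}.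
Local Notation C := (smooth_fun M).
Local Notation X_M := (vfield M).
Implicit Types (X Y Z : X_M) (g : metric M) (phi : endo M) (xi : X_M)
  (eta : one_form M).

(* A k-form is represented by its values on k-tuples of vector fields. *)
Definition form (k : nat) := ('I_k -> X_M) -> C.

Definition form1 eta : form 1 := fun v => eta (v ord0).

(* (d eta)(X, Y) = X (eta Y) - Y (eta X) - eta [X, Y], without factor 1/2 *)
Definition d1 eta X Y : C := X (eta Y) - Y (eta X) - eta (lie_bracket X Y).

Definition form2 (w : X_M -> X_M -> C) : form 2 :=
  fun v => w (v ord0) (v ord_max).

Definition d2 (w : X_M -> X_M -> C) X Y Z : C :=
  X (w Y Z) + Y (w Z X) + Z (w X Y)
  - w (lie_bracket X Y) Z - w (lie_bracket Y Z) X - w (lie_bracket Z X) Y.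

Definition wedge k l (a : form k) (b : form l) : form (k + l) := fun v =>
  smooth_cst M ((k`! * l`!)%:R^-1) *
  \sum_(s : 'S_(k + l)) (-1) ^+ odd_perm s *
    (a (fun i => v (s (lshift l i))) * b (fun j => v (s (rshift k j)))).

Fixpoint wedge_pow (w : form 2) (p : nat) : form (p * 2) :=
  if p is p'.+1 then wedge w (@wedge_pow w p') else fun=> 1.
Arguments wedge_pow w p v : clear implicits.

(* eta /\ (d eta)^p is nowhere zero and (d eta)^(p+1) = 0, where r = 2p + 1 *)
Definition has_rank eta (r : nat) : Prop :=
  exists p, [/\ r = (2 * p).+1,
    forall x : M, exists v,
      wedge (form1 eta) (wedge_pow (form2 (d1 eta)) p) v x != 0 &
    forall v, wedge_pow (form2 (d1 eta)) p.+1 v = 0].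

Definition almost_contact_metric g phi xi eta : Prop :=
  [/\ forall X, phi (phi X) = - X + eta X *: xi,
      eta xi = 1 &
      forall X Y, g (phi X) (phi Y) = g X Y - eta X * eta Y].

Definition nijenhuis phi X Y : X_M :=
  phi (phi (lie_bracket X Y)) + lie_bracket (phi X) (phi Y)
  - phi (lie_bracket (phi X) Y) - phi (lie_bracket X (phi Y)).

Definition normal phi xi eta : Prop :=
  forall X Y, nijenhuis phi X Y + d1 eta X Y *: xi = 0.

Definition fundamental_form g phi X Y : C := g X (phi Y).

Definition quasi_sasakian g phi xi eta : Prop :=
  [/\ almost_contact_metric g phi xi eta,
      normal phi xi eta &
      forall X Y Z, d2 (fundamental_form g phi) X Y Z = 0].

End Geometry.

Section ThreeStructures.
Context {R : realType} {d : nat} {M : manifold R d}.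
Local Notation X_M := (vfield M).
Implicit Types (X Y Z : X_M) (g : metric M) (phi : 'I_3 -> endo M)
  (xi : 'I_3 -> X_M) (eta : 'I_3 -> one_form M).

Definition for_even_perms (P : 'I_3 -> 'I_3 -> 'I_3 -> Prop) : Prop :=
  forall s : 'S_3, ~~ odd_perm s ->
    P (s (inord 0)) (s (inord 1)) (s (inord 2)).

Definition three_quasi_sasakian g phi xi eta : Prop :=
  (forall a, quasi_sasakian g (phi a) (xi a) (eta a)) /\
  for_even_perms (fun a b c =>
    [/\ forall X, phi c X = phi a (phi b X) - eta b X *: xi a,
        forall X, phi c X = - phi b (phi a X) + eta a X *: xi b,
        xi c = phi a (xi b) /\ xi c = - phi b (xi a),
        forall X, eta c X = eta a (phi b X) &
        forall X, eta c X = - eta b (phi a X)]).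

(* [D p X] means that the value of [X] at [p] belongs to the fibre of [D]. *)
Definition distribution := M -> set X_M.

Definition section_on (U : set M) (D : distribution) : set X_M :=
  [set X | forall p, U p -> D p X].

Definition perp g (D : distribution) : distribution := fun p =>
  [set X | forall Y, D p Y -> g X Y p = 0].

Definition horizontal eta : distribution := fun p =>
  [set X | forall a, eta a X p = 0].

Definition vertical xi : distribution := fun p =>
  [set X | exists v : 'I_3 -> R,
     same_at p X (\sum_a smooth_cst M (v a) *: xi a)].

Definition dist_E4m eta : distribution := fun p =>
  [set X | horizontal eta p X /\ forall a Y, d1 (eta a) X Y p = 0].

Definition dist_E4l3 g eta : distribution := perp g (dist_E4m eta).

Definition dist_E4l g xi eta : distribution := fun p =>
  dist_E4l3 g eta p `&` perp g (vertical xi) p.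

(* The orthogonal projection of a vector field onto a distribution: the smooth
   section [Y] of [D] with [X - Y] orthogonal to [D], and 0 if there is none. *)
Definition orth_proj g (D : distribution) X : X_M :=
  xget 0 [set Y | section_on setT D Y /\ section_on setT (perp g D) (X - Y)].

Definition levi_civita g (nabla : X_M -> X_M -> X_M) : Prop :=
  [/\ forall X Y Z (f : smooth_fun M),
        nabla (f *: X + Y) Z = f *: nabla X Z + nabla Y Z,
      forall X Y Z, nabla X (Y + Z) = nabla X Y + nabla X Z,
      forall X Y (f : smooth_fun M),
        nabla X (f *: Y) = (X f : smooth_fun M) *: Y + f *: nabla X Y,
      forall X Y, nabla X Y - nabla Y X = lie_bracket X Y &
      forall X Y Z,
        (X (g Y Z) : smooth_fun M) = g (nabla X Y) Z + g Y (nabla X Z)].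

Definition curvature (nabla : X_M -> X_M -> X_M) X Y Z : X_M :=
  nabla X (nabla Y Z) - nabla Y (nabla X Z) - nabla (lie_bracket X Y) Z.

Definition phi_sectional_curvature g nabla (phi : endo M) X : smooth_fun M :=
  g (curvature nabla X (phi X) (phi X)) X.

End ThreeStructures.

(* Main.v *)
Require Import Defs.
From HB Require Import structures.
From mathcomp Require Import all_boot all_order all_algebra all_fingroup.
From mathcomp Require Import all_classical all_reals all_analysis.
From mathcomp Require Import ring lra.
Set Implicit Arguments.
Unset Strict Implicit.
Unset Printing Implicit Defensive.
Import Order.TTheory GRing.Theory Num.Theory.
Import numFieldNormedType.Exports.
Local Open Scope classical_set_scope.
Local Open Scope ring_scope.

(** For each of the three structures normality and [d Phi = 0] make [xi] a
    Killing field and express [nabla phi] through the symmetric form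
    [a(X, Y) = g(nabla_X xi, phi Y)] and its operator [A = - phi o nabla xi].
    The quaternionic relations show that on horizontal vectors the three forms
    coincide, and closedness of [d eta_b], evaluated on [xi_a] and two
    horizontal fields, gives [A^2 = -(c/2) A].  Commuting the curvature with
    the [phi]'s and using the Bianchi identity one finds
    [H_1 + H_2 + H_3 = 3 a(X, X)^2], while the kernel of [A] on the horizontal
    distribution is [E^4m], so that [-(2/c) A] is the projection onto [E^4l].

    Vector fields being derivations, identifying this projection also needs
    that a vector field whose derivation vanishes at [p] is a combination of
    vector fields with coefficients vanishing at [p]; this follows from the
    Hadamard lemma in a chart and from bump functions. *)

(** * Calculus of vector fields *)

Section PointwiseEvaluation.
Context {R : realType} {d : nat} {M : manifold R d}.
Local Notation C := (smooth_fun M).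
Implicit Types (X Y : vfield M) (f h : C).

(** The constant of the theorem comes from [A^2 = -(c/2) A]: on horizontal vectors [A] has no
    eigenvalues besides [0] and [-c/2], so [a(X, X) = -(c/2) |X_{E^4l}|^2], and [3 a(X, X)^2]
    carries both the factor [3 c^2 / 4] and the square. For [c = 0] the symmetric operator [A]
    squares to zero on horizontal fields, hence vanishes there; this case is kept apart because the
    projection divides by [c].

    The form of the argument is dictated by two levels of horizontality. Equations such as
    [eta X = 0] get differentiated along arbitrary fields, so the tensor calculus is done for fields
    horizontal on all of [M], whereas the theorem speaks of fields horizontal only on an open set. A
    field is therefore replaced by its horizontal part, which differs from it by a combination of
    the [xi_i] whose coefficients vanish at the point considered; tensoriality preserves the values
    of curvature and metric there. *)

Definition lieder X f : C := X f.

Lemma sfunD f h p : (f + h) p = f p + h p. Proof. by []. Qed.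
Lemma sfunN f p : (- f) p = - f p. Proof. by []. Qed.
Lemma sfunM f h p : (f * h) p = f p * h p. Proof. by []. Qed.
Lemma sfun0 p : (0 : C) p = 0. Proof. by []. Qed.
Lemma sfun1 p : (1 : C) p = 1. Proof. by []. Qed.
Lemma sfun_cst a p : smooth_cst M a p = a. Proof. by []. Qed.

Definition sfunE := (sfunD, sfunN, sfunM, sfun0, sfun1, sfun_cst).

Lemma sfun_sum (I : Type) (r : seq I) (P : pred I) (F : I -> C) p :
  (\sum_(i <- r | P i) F i) p = \sum_(i <- r | P i) F i p.
Proof. by elim/big_ind2: _ => // f a h b <- <-. Qed.

Lemma sfunP f h : (forall p, f p = h p) -> f = h.
Proof. by move=> fh; apply/val_inj/funext. Qed.

Lemma lieder_linear (a : R) X f h :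
  lieder X (smooth_cst M a * f + h) = smooth_cst M a * lieder X f + lieder X h.
Proof. by case/asboolP: (valP X) => H _; exact: H. Qed.

Lemma liederM X f h : lieder X (f * h) = lieder X f * h + f * lieder X h.
Proof. by case/asboolP: (valP X) => _; apply. Qed.

Lemma liederD X f h : lieder X (f + h) = lieder X f + lieder X h.
Proof.
have e1 : smooth_cst M 1 = 1 by exact/sfunP.
by have := lieder_linear 1 X f h; rewrite e1 !mul1r.
Qed.

Lemma lieder0 X : lieder X 0 = 0.
Proof. by apply: (addrI (lieder X 0)); rewrite -liederD !addr0. Qed.

Lemma liederN X f : lieder X (- f) = - lieder X f.
Proof. by apply: (addrI (lieder X f)); rewrite -liederD !subrr lieder0. Qed.

Lemma lieder1 X : lieder X 1 = 0.
Proof.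
apply: (addrI (lieder X 1)); rewrite addr0.
by rewrite -[RHS](congr1 _ (mulr1 1)) liederM mulr1 mul1r.
Qed.

Lemma lieder_cst X a : lieder X (smooth_cst M a) = 0.
Proof.
have := lieder_linear a X 1 0.
by rewrite mulr1 !addr0 lieder1 mulr0 lieder0 addr0.
Qed.

Lemma liederDl X Y f : lieder (X + Y) f = lieder X f + lieder Y f.
Proof. by []. Qed.

Lemma liederNl X f : lieder (- X) f = - lieder X f. Proof. by []. Qed.

Lemma liederZl h X f : lieder (h *: X) f = h * lieder X f. Proof. by []. Qed.

Lemma lie_bracketE X Y f :
  lieder (lie_bracket X Y) f = lieder X (lieder Y f) - lieder Y (lieder X f).
Proof. by []. Qed.

Lemma vfieldP X Y : (forall f, lieder X f = lieder Y f) -> X = Y.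
Proof. by move=> XY; apply/val_inj/funext. Qed.

End PointwiseEvaluation.

Section Metric.
Context {R : realType} {d : nat} {M : manifold R d} (g : metric M).
Local Notation C := (smooth_fun M).
Implicit Types (X Y Z : vfield M) (f : C).

Lemma metricC X Y : g X Y = g Y X. Proof. exact: Defs.metric_sym. Qed.

Lemma metricDl X Y Z : g (X + Y) Z = g X Z + g Y Z.
Proof. by have := metric_linear g X Y Z 1; rewrite scale1r mul1r. Qed.

Lemma metric0l Z : g 0 Z = 0.
Proof. by apply: (addrI (g 0 Z)); rewrite -metricDl !addr0. Qed.

Lemma metricZl f X Z : g (f *: X) Z = f * g X Z.
Proof. by have := metric_linear g X 0 Z f; rewrite !addr0 metric0l addr0. Qed.

Lemma metricNl X Z : g (- X) Z = - g X Z.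
Proof. by rewrite -scaleN1r metricZl mulN1r. Qed.

Lemma metricDr X Y Z : g Z (X + Y) = g Z X + g Z Y.
Proof. by rewrite metricC metricDl !(metricC Z). Qed.

Lemma metric0r Z : g Z 0 = 0.
Proof. by rewrite metricC metric0l. Qed.

Lemma metricZr f X Z : g Z (f *: X) = f * g Z X.
Proof. by rewrite metricC metricZl metricC. Qed.

Lemma metricNr X Z : g Z (- X) = - g Z X.
Proof. by rewrite metricC metricNl metricC. Qed.

Definition metricE := (metricDl, metricDr, metricNl, metricNr, metricZl,
  metricZr, metric0l, metric0r).

Lemma metric_suml (I : Type) (r : seq I) (P : pred I) (F : I -> vfield M) Z :
  g (\sum_(i <- r | P i) F i) Z = \sum_(i <- r | P i) g (F i) Z.
Proof.
elim/big_ind2: _ => [|X f Y h <- <-|//]; first exact: metric0l.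
by rewrite metricDl.
Qed.

Lemma metric_eq0 X : (forall p, g X X p = 0) -> X = 0.
Proof.
move=> gX; apply: vfieldP => f; apply: sfunP => p.
have [//|/(metric_pos g)] := pselect (same_at p X 0).
by rewrite gX ltxx.
Qed.

Lemma metric_nondegenerate X Y : (forall Z, g X Z = g Y Z) -> X = Y.
Proof.
move=> XY; apply/eqP; rewrite -subr_eq0; apply/eqP/metric_eq0 => p.
by rewrite metricDl metricNl XY subrr.
Qed.

End Metric.

Section LeviCivita.
Context {R : realType} {d : nat} {M : manifold R d} {g : metric M}.
Context {nabla : vfield M -> vfield M -> vfield M}.
Hypothesis hnabla : levi_civita g nabla.
Local Notation C := (smooth_fun M).
Implicit Types (X Y Z : vfield M) (f : C).

Lemma nablaDl X Y Z : nabla (X + Y) Z = nabla X Z + nabla Y Z.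
Proof. by case: hnabla => /(_ X Y Z 1); rewrite !scale1r. Qed.

Lemma nabla0l Z : nabla 0 Z = 0.
Proof. by apply: (addrI (nabla 0 Z)); rewrite -nablaDl !addr0. Qed.

Lemma nablaZl f X Z : nabla (f *: X) Z = f *: nabla X Z.
Proof. by case: hnabla => /(_ X 0 Z f); rewrite nabla0l !addr0. Qed.

Lemma nablaNl X Z : nabla (- X) Z = - nabla X Z.
Proof. by rewrite -scaleN1r nablaZl scaleN1r. Qed.

Lemma nablaDr X Y Z : nabla X (Y + Z) = nabla X Y + nabla X Z.
Proof. by case: hnabla => _ H _ _ _; exact: H. Qed.

Lemma nabla0r X : nabla X 0 = 0.
Proof. by apply: (addrI (nabla X 0)); rewrite -nablaDr !addr0. Qed.

Lemma nablaZr f X Y : nabla X (f *: Y) = lieder X f *: Y + f *: nabla X Y.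
Proof. by case: hnabla => _ _ H _ _; exact: H. Qed.

Lemma nablaNr X Y : nabla X (- Y) = - nabla X Y.
Proof. by apply: (addrI (nabla X Y)); rewrite -nablaDr !subrr nabla0r. Qed.

Lemma lie_bracket_nabla X Y : lie_bracket X Y = nabla X Y - nabla Y X.
Proof. by case: hnabla => _ _ _ H _. Qed.

Lemma lieder_metric X Y Z :
  lieder X (g Y Z) = g (nabla X Y) Z + g Y (nabla X Z).
Proof. by case: hnabla => _ _ _ _ H; exact: H. Qed.

End LeviCivita.

(** * Quasi-Sasakian structures *)

Section TensorsOfAStructure.
Context {R : realType} {d : nat} {M : manifold R d} (g : metric M).
Context (nabla : vfield M -> vfield M -> vfield M).
Implicit Types (phi : endo M) (xi : vfield M).

(** Once [xi] is known to be Killing, this is half of [d eta]. *)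
Definition vorticity xi X Y : smooth_fun M := g (nabla X xi) Y.

Definition vorticity_phi phi xi X Y : smooth_fun M := vorticity xi X (phi Y).

Definition cov_deriv phi X Y : vfield M := nabla X (phi Y) - phi (nabla X Y).

Definition cov_deriv_form phi X Y Z : smooth_fun M := g (cov_deriv phi X Y) Z.

(** The operator of the form [vorticity_phi]; when [nabla_X xi = - phi X], as in the Sasakian case,
    it is [phi^2]. *)
Definition shape phi xi X : vfield M := - phi (nabla X xi).

End TensorsOfAStructure.

Section QuasiSasakian.
Context {R : realType} {d : nat} {M : manifold R d} {g : metric M}.
Context {nabla : vfield M -> vfield M -> vfield M}.
Hypothesis hnabla : levi_civita g nabla.
Context {phi : endo M} {xi : vfield M} {eta : one_form M}.
Hypothesis hqs : quasi_sasakian g phi xi eta.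
Local Notation C := (smooth_fun M).
Implicit Types (X Y Z W : vfield M) (f : C).
Local Notation w := (vorticity g nabla xi).
Local Notation a := (vorticity_phi g nabla phi xi).
Local Notation F := (cov_deriv nabla phi).
Local Notation T := (cov_deriv_form g nabla phi).
Local Notation A := (shape nabla phi xi).

Lemma phi2 X : phi (phi X) = - X + eta X *: xi.
Proof. by case: hqs => -[H _ _] _ _. Qed.

Lemma eta_xi : eta xi = 1.
Proof. by case: hqs => -[_ H _] _ _. Qed.

Lemma metric_phi X Y : g (phi X) (phi Y) = g X Y - eta X * eta Y.
Proof. by case: hqs => -[_ _ H] _ _. Qed.

(** As [phi^2 xi = 0], evaluating [phi^3 xi] shows that [phi xi = f xi]; one more [phi] gives
    [f^2 = 0], hence [f = 0] at every point. *)
Lemma phi_xi : phi xi = 0.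
Proof.
have p2 : phi (phi xi) = 0 by rewrite phi2 eta_xi scale1r addNr.
have e1 : phi xi = eta (phi xi) *: xi.
  by apply: (addrI (- phi xi)); rewrite -phi2 addNr p2 linear0.
have e0 : eta (phi xi) = 0.
  have : eta (phi xi) * eta (phi xi) = 0.
    transitivity (eta (phi (eta (phi xi) *: xi))); first by rewrite !linearZ.
    by rewrite -e1 p2 linear0.
  move=> ff; apply: sfunP => p; move/(congr1 (fun f : C => f p)): ff.
  by rewrite !sfunE => /eqP; rewrite mulf_eq0 orbb => /eqP.
by rewrite e1 e0 scale0r.
Qed.

(** Computing [phi^3 X] as [phi^2 (phi X)] and as [phi (phi^2 X)] gives expressions that differ by
    this multiple of [xi]. *)
Lemma eta_phi X : eta (phi X) = 0.
Proof.
have : eta (phi X) *: xi = 0.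
  apply: (addrI (- phi X)); rewrite -phi2 [phi (phi X)]phi2.
  by rewrite linearD linearN linearZ /= phi_xi scaler0.
by move/(congr1 eta); rewrite linearZ /= eta_xi mulr1 linear0.
Qed.

Lemma etaE X : eta X = g X xi.
Proof.
apply/eqP; rewrite -subr_eq0 -opprB oppr_eq0; apply/eqP.
by rewrite -[eta X]mulr1 -eta_xi -metric_phi phi_xi metric0r.
Qed.

Lemma phi_skew X Y : g (phi X) Y = - g X (phi Y).
Proof.
have := metric_phi X (phi Y); rewrite phi2 eta_phi mulr0 subr0 => <-.
by rewrite metricDr metricNr metricZr -etaE eta_phi mulr0 addr0 opprK.
Qed.

Lemma vorticityDl X Y Z : w (X + Y) Z = w X Z + w Y Z.
Proof. by rewrite /vorticity (nablaDl hnabla) metricDl. Qed.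
Lemma vorticityNl X Z : w (- X) Z = - w X Z.
Proof. by rewrite /vorticity (nablaNl hnabla) metricNl. Qed.
Lemma vorticityZl f X Z : w (f *: X) Z = f * w X Z.
Proof. by rewrite /vorticity (nablaZl hnabla) metricZl. Qed.
Lemma vorticityDr X Y Z : w X (Y + Z) = w X Y + w X Z.
Proof. exact: metricDr. Qed.
Lemma vorticityNr X Z : w X (- Z) = - w X Z.
Proof. exact: metricNr. Qed.
Lemma vorticityZr f X Z : w X (f *: Z) = f * w X Z.
Proof. exact: metricZr. Qed.

Definition vorticityE := (vorticityDl, vorticityNl, vorticityZl,
  vorticityDr, vorticityNr, vorticityZr).

(** [xi] has constant length. *)
Lemma vorticity_xir X : w X xi = 0.
Proof.
apply: sfunP => p; have := lieder_metric hnabla X xi xi.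
rewrite -etaE eta_xi lieder1 (metricC _ xi) => /(congr1 (fun f : C => f p)).
rewrite !sfunE /vorticity; lra.
Qed.

Lemma lieder_eta X Y : lieder X (eta Y) = eta (nabla X Y) + w X Y.
Proof. by rewrite !etaE (lieder_metric hnabla) (metricC _ Y). Qed.

Lemma d1_vorticity X Y : d1 eta X Y = w X Y - w Y X.
Proof.
rewrite /d1 -!/(lieder _ _) !lieder_eta (lie_bracket_nabla hnabla) linearB /=.
ring.
Qed.

Lemma cov_derivDl X Y Z : F (X + Y) Z = F X Z + F Y Z.
Proof.
by rewrite /cov_deriv !(nablaDl hnabla) linearD /= opprD addrACA.
Qed.
Lemma cov_derivNl X Z : F (- X) Z = - F X Z.
Proof. by rewrite /cov_deriv !(nablaNl hnabla) linearN /= opprD. Qed.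
Lemma cov_derivZl f X Z : F (f *: X) Z = f *: F X Z.
Proof. by rewrite /cov_deriv !(nablaZl hnabla) linearZ /= scalerBr. Qed.
Lemma cov_derivDr X Y Z : F X (Y + Z) = F X Y + F X Z.
Proof.
by rewrite /cov_deriv linearD !(nablaDr hnabla) linearD /= opprD addrACA.
Qed.
Lemma cov_derivNr X Z : F X (- Z) = - F X Z.
Proof. by rewrite /cov_deriv linearN !(nablaNr hnabla) linearN /= opprD. Qed.
Lemma cov_derivZr f X Z : F X (f *: Z) = f *: F X Z.
Proof.
rewrite /cov_deriv linearZ /= !(nablaZr hnabla) linearD !linearZ /=.
by rewrite opprD addrACA subrr add0r scalerBr.
Qed.

Lemma cov_deriv_form_skew X Y Z : T X Y Z = - T X Z Y.
Proof.
apply: sfunP => p; rewrite /cov_deriv_form /cov_deriv !metricE !phi_skew.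
have := lieder_metric hnabla X (phi Y) Z.
have := lieder_metric hnabla X Y (phi Z).
rewrite phi_skew liederN => -> /(congr1 (fun f : C => f p)).
rewrite (metricC g Y) (metricC g (phi Y)) !sfunE; lra.
Qed.

(** [d Phi = 0], with brackets replaced by covariant derivatives. *)
Lemma cov_deriv_form_cyclic X Y Z : T X Y Z + T Y Z X + T Z X Y = 0.
Proof.
case: hqs => _ _ /(_ X Y Z) H; apply: sfunP => p.
have := congr1 (fun f : C => f p) H.
rewrite /d2 /fundamental_form -!/(lieder _ _) !(lieder_metric hnabla).
rewrite !(lie_bracket_nabla hnabla) !metricE !sfunE.
rewrite (cov_deriv_form_skew X) (cov_deriv_form_skew Y) (cov_deriv_form_skew Z).
rewrite /cov_deriv_form /cov_deriv !metricE !phi_skew !sfunE.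
rewrite (metricC _ Y) (metricC _ Z) (metricC _ X).
lra.
Qed.

(** Normality paired with [Z], brackets again replaced by covariant derivatives. *)
Lemma cov_deriv_form_normal X Y Z :
  T (phi X) Y Z - T (phi Y) X Z + T X Y (phi Z) - T Y X (phi Z)
  + (w X Y - w Y X) * eta Z = 0.
Proof.
case: hqs => _ /(_ X Y) /(congr1 (g^~ Z)) + _.
rewrite d1_vorticity /nijenhuis !(lie_bracket_nabla hnabla).
rewrite /cov_deriv_form /cov_deriv !linearB /= !metricE !phi_skew => <-.
rewrite (metricC _ xi) -etaE; apply: sfunP => p.
rewrite !sfunE; lra.
Qed.

Lemma cov_deriv_form_xi X Z : T X xi Z = w X (phi Z).
Proof.
rewrite /cov_deriv_form /cov_deriv phi_xi (nabla0r hnabla) sub0r metricNl.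
by rewrite phi_skew opprK.
Qed.

Lemma cov_deriv_form_phi2l X Y Z :
  T (phi (phi X)) Y Z = - T X Y Z + eta X * T xi Y Z.
Proof.
by rewrite phi2 {1}/cov_deriv_form cov_derivDl cov_derivNl cov_derivZl
  metricDl metricNl metricZl.
Qed.

Lemma cov_deriv_form_phi2m X Y Z :
  T X (phi (phi Y)) Z = - T X Y Z + eta Y * T X xi Z.
Proof.
by rewrite phi2 {1}/cov_deriv_form cov_derivDr cov_derivNr cov_derivZr
  metricDl metricNl metricZl.
Qed.

Lemma cov_deriv_form_phi2r X Y Z :
  T X Y (phi (phi Z)) = - T X Y Z + eta Z * T X Y xi.
Proof. by rewrite phi2 {1}/cov_deriv_form metricDr metricNr metricZr. Qed.

Lemma cov_deriv_form0l Y Z : T 0 Y Z = 0.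
Proof.
by rewrite /cov_deriv_form /cov_deriv !(nabla0l hnabla) linear0 subr0 metric0l.
Qed.

Lemma cov_deriv_form0r X Y : T X Y 0 = 0.
Proof. exact: metric0r. Qed.

Lemma vorticity0r X : w X 0 = 0.
Proof. exact: metric0r. Qed.

(** In the normality identity at [(xi, Y, xi)] every other term contains [phi xi] or is a [w _ xi].
    Thus the orbits of [xi] are geodesics. *)
Lemma vorticity_xil Y : w xi Y = 0.
Proof.
have := cov_deriv_form_normal xi Y xi.
rewrite phi_xi cov_deriv_form0l !cov_deriv_form0r cov_deriv_form_xi phi_xi.
by rewrite vorticity0r eta_xi vorticity_xir mulr1 !subr0 !add0r.
Qed.

Lemma vorticity_phi2l X Y : w (phi (phi X)) Y = - w X Y.
Proof. by rewrite phi2 !vorticityE vorticity_xil mulr0 addr0. Qed.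

Lemma vorticity_phi2r X Y : w X (phi (phi Y)) = - w X Y.
Proof. by rewrite phi2 !vorticityE vorticity_xir mulr0 addr0. Qed.

Lemma cov_deriv_form_xil Y Z : T xi Y Z = w Y (phi Z) - w Z (phi Y).
Proof.
have := cov_deriv_form_cyclic xi Y Z.
rewrite (cov_deriv_form_skew Y) !cov_deriv_form_xi.
move=> /(congr1 (fun f : C => f _)) H; apply: sfunP => p.
move: (H p); rewrite !sfunE; lra.
Qed.

(** Normality at [(xi, X, Y)]; the two terms containing [phi^2 Y] cancel. *)
Lemma vorticity_phi_phi_skew X Y : w (phi X) (phi Y) = - w (phi Y) (phi X).
Proof.
have := cov_deriv_form_normal xi X Y.
rewrite phi_xi cov_deriv_form0l !cov_deriv_form_xi cov_deriv_form_xil.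
rewrite vorticity_xil vorticity_xir.
move=> /(congr1 (fun f : C => f _)) H; apply: sfunP => p.
move: (H p); rewrite !sfunE; lra.
Qed.

(* [xi] is a Killing field. *)
Lemma vorticity_skew X Y : w X Y = - w Y X.
Proof.
have := vorticity_phi_phi_skew (phi X) (phi Y).
by rewrite !vorticity_phi2l !vorticity_phi2r !opprK.
Qed.

(** Normality at [(X, Y, xi)]: the torsion gives [-2 w (phi X) (phi Y)] and [d eta] gives
    [2 w X Y]. *)
Lemma vorticity_phi_phi X Y : w (phi X) (phi Y) = w X Y.
Proof.
have := cov_deriv_form_normal X Y xi.
rewrite phi_xi !cov_deriv_form0r eta_xi !(cov_deriv_form_skew _ _ xi).
rewrite !cov_deriv_form_xi (vorticity_skew (phi Y)) (vorticity_skew Y).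
move=> /(congr1 (fun f : C => f _)) H; apply: sfunP => p.
move: (H p); rewrite !sfunE; lra.
Qed.

Lemma vorticity_phir X Y : w X (phi Y) = - w (phi X) Y.
Proof. by rewrite -vorticity_phi_phi vorticity_phi2r. Qed.

Lemma vorticity_phi_sym X Y : a X Y = a Y X.
Proof.
by rewrite /vorticity_phi vorticity_phir (vorticity_skew (phi X)) opprK.
Qed.

Lemma vorticity_phi_phi_phi X Y : a (phi X) (phi Y) = a X Y.
Proof. exact: vorticity_phi_phi. Qed.

Lemma d1_eta X Y : d1 eta X Y = w X Y + w X Y.
Proof. by rewrite d1_vorticity (vorticity_skew Y) opprK. Qed.

Lemma cov_deriv_form_xil0 Y Z : T xi Y Z = 0.
Proof.
rewrite cov_deriv_form_xil -!/(vorticity_phi _ _ _ _ _ _).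
by rewrite vorticity_phi_sym subrr.
Qed.

(** Normality and closedness combine into [t_1 + t_2 = t_3] for the values [t_i] of [T (phi _) _ _]
    at the three rotations of [(X, Y, Z)]; together with its own rotations this leaves only zero. *)
Lemma cov_deriv_form_horizontal X Y Z :
  eta X = 0 -> eta Y = 0 -> eta Z = 0 -> T (phi X) Y Z = 0.
Proof.
move=> X0 Y0 Z0; apply: sfunP => p.
have N U V W : eta W = 0 -> T (phi U) V W p + T (phi V) W U p = T (phi W) U V p.
  move=> W0; have := congr1 (fun f : C => f p) (cov_deriv_form_normal U V W).
  have := congr1 (fun f : C => f p) (cov_deriv_form_cyclic U V (phi W)).
  rewrite W0 mulr0 addr0 (cov_deriv_form_skew V U) (cov_deriv_form_skew (phi V)).
  rewrite !sfunE; lra.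
move: (N X Y Z Z0) (N Y Z X X0) (N Z X Y Y0); rewrite sfunE; lra.
Qed.

(** The classical formula [(nabla_X phi) Y = eta(Y) A X - g(A X, Y) xi], paired with [Z]. Applying
    powers of [phi] makes all arguments horizontal; expanding [phi^2] then leaves only components
    along [xi], which are already known. *)
Lemma cov_deriv_formE X Y Z : T X Y Z = a X Z * eta Y - a X Y * eta Z.
Proof.
have := @cov_deriv_form_horizontal (phi X) (phi (phi Y)) (phi (phi Z))
  (eta_phi _) (eta_phi _) (eta_phi _).
rewrite cov_deriv_form_phi2l cov_deriv_form_xil0 cov_deriv_form_phi2m.
rewrite !cov_deriv_form_phi2r cov_deriv_form_xi.
rewrite (cov_deriv_form_skew X Y xi) !(cov_deriv_form_xi X).
rewrite phi_xi vorticity0r /vorticity_phi.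
move=> /(congr1 (fun f : C => f _)) H; apply: sfunP => p.
move: (H p); rewrite !sfunE; lra.
Qed.

Lemma shapeE X Y : g (A X) Y = a X Y.
Proof. by rewrite /shape metricNl phi_skew opprK. Qed.

Lemma cov_derivE_shape X Y : F X Y = eta Y *: A X - a X Y *: xi.
Proof.
apply: (metric_nondegenerate (g := g)) => Z.
rewrite -/(cov_deriv_form _ _ _ _ _ _) cov_deriv_formE.
by rewrite metricDl metricNl !metricZl shapeE (metricC _ xi) -etaE mulrC.
Qed.

Lemma phi_shape X : phi (A X) = nabla X xi.
Proof.
rewrite /shape linearN /= phi2 etaE -/(vorticity _ _ _ _ _) vorticity_xir.
by rewrite scale0r addr0 opprK.
Qed.

Lemma shape_phi X : A (phi X) = phi (A X).
Proof.
apply: (metric_nondegenerate (g := g)) => Z.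
rewrite phi_skew !shapeE /vorticity_phi vorticity_phi2r vorticity_phi_phi.
by rewrite opprK.
Qed.

End QuasiSasakian.

(** * Curvature *)

Section Curvature.
Context {R : realType} {d : nat} {M : manifold R d} {g : metric M}.
Context {nabla : vfield M -> vfield M -> vfield M}.
Hypothesis hnabla : levi_civita g nabla.
Local Notation C := (smooth_fun M).
Implicit Types (X Y Z W U : vfield M) (f : C).

Definition riemann X Y Z W : C := g (curvature nabla X Y Z) W.

Local Notation Rm := riemann.

Lemma lie_bracket_skew X Y : lie_bracket X Y = - lie_bracket Y X.
Proof. by apply: vfieldP => f; rewrite liederNl !lie_bracketE opprB. Qed.

Lemma jacobi X Y Z : lie_bracket X (lie_bracket Y Z)
  + lie_bracket Y (lie_bracket Z X) + lie_bracket Z (lie_bracket X Y) = 0.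
Proof.
apply: vfieldP => f; rewrite !liederDl !lie_bracketE !(liederD, liederN).
apply: sfunP => p; rewrite !sfunE; lra.
Qed.

(** After the second derivatives cancel, what remains is [eta] of the Jacobi identity. *)
Lemma d2_d1 (eta : one_form M) X Y Z : d2 (d1 eta) X Y Z = 0.
Proof.
have := congr1 eta (jacobi X Y Z).
rewrite (lie_bracket_skew X (lie_bracket _ _)).
rewrite (lie_bracket_skew Y (lie_bracket _ _)).
rewrite (lie_bracket_skew Z (lie_bracket _ _)) !linearD !linearN linear0 /=.
move/(congr1 (fun f : C => f _)) => H; apply: sfunP => p; move: (H p).
rewrite /d2 /d1 -!/(lieder _ _) !(liederD, liederN).
rewrite !sfunE; lra.
Qed.

Lemma curvatureDl X Y Z W :
  curvature nabla (X + Y) Z W = curvature nabla X Z W + curvature nabla Y Z W.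
Proof.
apply: (metric_nondegenerate (g := g)) => U; apply: sfunP => p.
rewrite /curvature !(lie_bracket_nabla hnabla).
rewrite !(nablaDl hnabla, nablaNl hnabla, nablaDr hnabla).
rewrite !metricE !sfunE; lra.
Qed.

Lemma curvatureZl f X Z W :
  curvature nabla (f *: X) Z W = f *: curvature nabla X Z W.
Proof.
apply: (metric_nondegenerate (g := g)) => U; apply: sfunP => p.
rewrite /curvature !(lie_bracket_nabla hnabla).
rewrite !(nablaZl hnabla, nablaDl hnabla, nablaNl hnabla, nablaDr hnabla,
  nablaZr hnabla).
rewrite !metricE !sfunE; lra.
Qed.

Lemma curvature_skew X Y Z : curvature nabla X Y Z = - curvature nabla Y X Z.
Proof.
rewrite /curvature (lie_bracket_skew X) (nablaNl hnabla).
apply: (metric_nondegenerate (g := g)) => U; apply: sfunP => p.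
rewrite !metricE !sfunE; lra.
Qed.

Lemma bianchi X Y Z : curvature nabla X Y Z + curvature nabla Y Z X
  + curvature nabla Z X Y = 0.
Proof.
rewrite -[RHS](jacobi X Y Z) /curvature !(lie_bracket_nabla hnabla).
apply: (metric_nondegenerate (g := g)) => U; apply: sfunP => p.
rewrite !(nablaDl hnabla, nablaNl hnabla, nablaDr hnabla, nablaNr hnabla).
rewrite !metricE !sfunE; lra.
Qed.

Lemma riemann_skewl X Y Z W : Rm X Y Z W = - Rm Y X Z W.
Proof. by rewrite /riemann curvature_skew metricNl. Qed.

Lemma riemann_skewr X Y Z W : Rm X Y Z W = - Rm X Y W Z.
Proof.
have := lie_bracketE X Y (g Z W).
rewrite !(lieder_metric hnabla) !liederD !(lieder_metric hnabla).
move/(congr1 (fun f : C => f _)) => H; apply: sfunP => p; move: (H p).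
rewrite /riemann /curvature !metricE !(metricC g Z) !sfunE; lra.
Qed.

Lemma riemann_bianchi X Y Z W : Rm X Y Z W + Rm Y Z X W + Rm Z X Y W = 0.
Proof. by rewrite /riemann -!metricDl bianchi metric0l. Qed.

(** The Bianchi identities at the four rotations of [(X, Y, Z, W)] are combined; the rewrites first
    normalize each term by the two skew symmetries. *)
Lemma riemann_sym X Y Z W : Rm X Y Z W = Rm Z W X Y.
Proof.
apply: sfunP => p.
have B U V S Q : Rm U V S Q p + Rm V S U Q p + Rm S U V Q p = 0.
  by have := congr1 (fun f : C => f p) (riemann_bianchi U V S Q).
have l U V S Q : Rm U V S Q p = - Rm V U S Q p.
  by have := congr1 (fun f : C => f p) (riemann_skewl U V S Q).
have r U V S Q : Rm U V S Q p = - Rm U V Q S p.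
  by have := congr1 (fun f : C => f p) (riemann_skewr U V S Q).
move: (B X Y Z W) (B Y Z W X) (B Z W X Y) (B W X Y Z).
rewrite (r Y Z W X) (l Y Z X W) (r X Y W Z).
rewrite (r Z W Y X) (l W Y Z X) (r Y W Z X) (l Z X Y W) (r X Z Y W).
rewrite (r W X Z Y) (l X Z W Y) (l Y W X Z) (r W Y X Z) (r W X Y Z).
lra.
Qed.

Lemma riemannDl X Y Z W U : Rm (X + Y) Z W U = Rm X Z W U + Rm Y Z W U.
Proof. by rewrite /riemann curvatureDl metricDl. Qed.
Lemma riemannZl f X Z W U : Rm (f *: X) Z W U = f * Rm X Z W U.
Proof. by rewrite /riemann curvatureZl metricZl. Qed.
Lemma riemannDr X Y Z W U : Rm Z W U (X + Y) = Rm Z W U X + Rm Z W U Y.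
Proof. exact: metricDr. Qed.
Lemma riemannZr f X Z W U : Rm Z W U (f *: X) = f * Rm Z W U X.
Proof. exact: metricZr. Qed.
Lemma riemannDm X Y Z W U : Rm Z (X + Y) W U = Rm Z X W U + Rm Z Y W U.
Proof. by rewrite riemann_skewl riemannDl opprD -!riemann_skewl. Qed.
Lemma riemannZm f X Z W U : Rm Z (f *: X) W U = f * Rm Z X W U.
Proof. by rewrite riemann_skewl riemannZl -mulrN -!riemann_skewl. Qed.
Lemma riemannDn X Y Z W U : Rm Z W (X + Y) U = Rm Z W X U + Rm Z W Y U.
Proof. by rewrite riemann_skewr riemannDr opprD -!riemann_skewr. Qed.
Lemma riemannZn f X Z W U : Rm Z W (f *: X) U = f * Rm Z W X U.
Proof. by rewrite riemann_skewr riemannZr -mulrN -!riemann_skewr. Qed.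

Context {phi : endo M} {xi : vfield M} {eta : one_form M}.
Hypothesis hqs : quasi_sasakian g phi xi eta.
Local Notation w := (vorticity g nabla xi).
Local Notation a := (vorticity_phi g nabla phi xi).

Definition cov_vorticity X Y Z : C :=
  lieder X (w Y Z) - w (nabla X Y) Z - w Y (nabla X Z).

(* This is [d (d eta) = 0], as [d eta = 2 w]. *)
Lemma cov_vorticity_cyclic X Y Z :
  cov_vorticity X Y Z + cov_vorticity Y Z X + cov_vorticity Z X Y = 0.
Proof.
have := d2_d1 eta X Y Z.
rewrite /d2 /cov_vorticity -!/(lieder _ _) !(d1_eta hnabla hqs).
rewrite !liederD !(lie_bracket_nabla hnabla).
rewrite !(vorticityE hnabla).
move/(congr1 (fun f : C => f _)) => H; apply: sfunP => p; move: (H p).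
rewrite !(vorticity_skew hnabla hqs X) !(vorticity_skew hnabla hqs Y).
rewrite !(vorticity_skew hnabla hqs Z).
rewrite !(liederN) !sfunE; lra.
Qed.

(** In the cyclic identity the other two terms are opposite: up to sign both are the symmetric
    product [g (nabla Z xi) (nabla Y xi)]. *)
Lemma cov_vorticity_xi Y Z : cov_vorticity xi Y Z = 0.
Proof.
have := cov_vorticity_cyclic xi Y Z.
have -> : cov_vorticity Y Z xi = - g (nabla Z xi) (nabla Y xi).
  rewrite /cov_vorticity !(vorticity_xir hnabla hqs) lieder0 subrr sub0r.
  by [].
have -> : cov_vorticity Z xi Y = g (nabla Z xi) (nabla Y xi).
  rewrite /cov_vorticity !(vorticity_xil hnabla hqs) lieder0 subr0 sub0r.
  by rewrite (vorticity_skew hnabla hqs) opprK /vorticity metricC.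
by rewrite -addrA addNr addr0.
Qed.

(** The left side is [R(phi Z) - phi (R Z)] paired with [W]. Expanding [nabla phi] leaves terms
    quadratic in [nabla xi]; the derivatives of [a] appear as coefficients of [xi] and disappear
    since [W] is orthogonal to it. *)
Lemma riemann_phi X Y Z W : eta Z = 0 -> eta W = 0 ->
  Rm X Y (phi Z) W + Rm X Y Z (phi W) =
  w X Z * a Y W - a Y Z * w X W - w Y Z * a X W + a X Z * w Y W.
Proof.
move=> Z0 W0.
have N U V : nabla U (phi V) = phi (nabla U V) + cov_deriv nabla phi U V.
  by rewrite /cov_deriv addrC subrK.
have eN U : eta (nabla U Z) = - w U Z.
  have := lieder_eta hnabla hqs U Z; rewrite Z0 lieder0 => /esym/eqP.
  by rewrite addr_eq0 => /eqP.
have W1 : g xi W = 0 by rewrite metricC -(etaE hqs).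
rewrite /riemann -[g _ (phi W)]opprK -(phi_skew hqs).
rewrite /curvature !N !(nablaDr hnabla) !N.
rewrite !(cov_derivE_shape hnabla hqs) Z0 !scale0r !sub0r !eN.
rewrite !(nablaDr hnabla, nablaNr hnabla, nablaZr hnabla) !linearB /=.
apply: sfunP => p.
rewrite !(shapeE hqs, metricE) !W1 !sfunE /vorticity.
lra.
Qed.

End Curvature.

(** * 3-quasi-Sasakian structures *)

Section CyclicTriples.

(** Addition in ['I_3] is modulo 3, so these are the images of [(0, 1, 2)] under even permutations,
    in a form visibly stable under rotation. *)
Definition cyclic_triple (i j k : 'I_3) : Prop :=
  [/\ j = i + 1, k = j + 1 & i = k + 1].

Lemma cyclic_tripleP (i : 'I_3) : cyclic_triple i (i + 1) (i + 1 + 1).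
Proof. by split => //; apply/val_inj; case: i => [[|[|[|]]]]. Qed.

Lemma cyclic_triple_rot i j k : cyclic_triple i j k -> cyclic_triple j k i.
Proof. by case. Qed.

Lemma cyclic_triple_ind (P : 'I_3 -> Prop) i j k : cyclic_triple i j k ->
  P i -> P j -> P k -> forall l, P l.
Proof.
move=> [-> -> _] Pi Pj Pk l.
suff : [|| l == i, l == i + 1 | l == i + 1 + 1] by case/or3P => /eqP ->.
by case: i {Pi Pj Pk} l => [[|[|[|//]]] ?] [[|[|[|//]]] ?].
Qed.

Lemma cyclic_triple_sum (V : nmodType) (F : 'I_3 -> V) i j k :
  cyclic_triple i j k -> \sum_l F l = F i + F j + F k.
Proof.
move=> [-> -> _]; rewrite (reindex_inj (addrI i)) /=.
rewrite !big_ord_recl big_ord0 [X in _ + (_ + X)]addr0 addrA.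
by congr (_ + _ + _); congr F; apply/val_inj; case: i => [[|[|[|]]]].
Qed.

Lemma for_even_perms_cyclic (P : 'I_3 -> 'I_3 -> 'I_3 -> Prop) i j k :
  cyclic_triple i j k -> for_even_perms P -> P i j k.
Proof.
move=> [-> -> _] H.
pose s := perm (addrI i); have sE x : s x = i + x by rewrite permE.
have : ~~ odd_perm s.
  (* The translation by [i] has trivial cube, and a permutation has the parity of its cube. *)
  have : odd_perm (s * s * s)%g = false.
    rewrite (_ : (s * s * s)%g = 1%g) ?odd_perm1//.
    apply/permP => x; rewrite !permM !sE perm1.
    by apply/val_inj; case: i {s sE} x => [[|[|[|//]]] ?] [[|[|[|//]]] ?].
  by rewrite !odd_permM; case: odd_perm.
move/H; rewrite !sE; congr P; apply/val_inj => /=; rewrite !inordK//.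
all: by case: i {s sE} => [[|[|[|]]]].
Qed.

End CyclicTriples.

Section ThreeQuasiSasakian.
Context {R : realType} {d : nat} {M : manifold R d} {g : metric M}.
Context {nabla : vfield M -> vfield M -> vfield M}.
Hypothesis hnabla : levi_civita g nabla.
Context {phi : 'I_3 -> endo M} {xi : 'I_3 -> vfield M}
  {eta : 'I_3 -> one_form M} {c : R}.
Hypothesis h3qs : three_quasi_sasakian g phi xi eta.
Hypothesis hc : for_even_perms (fun a b k =>
  lie_bracket (xi a) (xi b) = smooth_cst M c *: xi k).
Local Notation C := (smooth_fun M).
Implicit Types (X Y Z W U : vfield M) (f : C) (i j k : 'I_3).
Local Notation w i := (vorticity g nabla (xi i)).
Local Notation a i := (vorticity_phi g nabla (phi i) (xi i)).
Local Notation A i := (shape nabla (phi i) (xi i)).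

(** Horizontal on the whole of [M], so that the equations [eta i X = 0] can be differentiated;
    [horizontal] is the pointwise notion. *)
Definition hor X := forall i, eta i X = 0.

Let qs i : quasi_sasakian g (phi i) (xi i) (eta i).
Proof. by case: h3qs. Qed.

Lemma three_relations i j k : cyclic_triple i j k ->
  [/\ forall X, phi k X = phi i (phi j X) - eta j X *: xi i,
      forall X, phi k X = - phi j (phi i X) + eta i X *: xi j,
      xi k = phi i (xi j) /\ xi k = - phi j (xi i),
      forall X, eta k X = eta i (phi j X) &
      forall X, eta k X = - eta j (phi i X)].
Proof.
by move=> ijk; case: h3qs => _ /(for_even_perms_cyclic ijk).
Qed.

Lemma bracket_xi i j k : cyclic_triple i j k ->
  lie_bracket (xi i) (xi j) = smooth_cst M c *: xi k.
Proof. by move=> ijk; have := for_even_perms_cyclic ijk hc. Qed.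

(** Each of the two fields lies in the image of the other's [phi], which the corresponding [eta]
    kills. *)
Lemma eta_xi_orth i j k : cyclic_triple i j k ->
  eta i (xi j) = 0 /\ eta j (xi i) = 0.
Proof.
move=> ijk; have jki := cyclic_triple_rot ijk; have kij := cyclic_triple_rot jki.
have [_ _ [_ ->] _ _] := three_relations kij.
have [_ _ [-> _] _ _] := three_relations jki.
by rewrite linearN /= !(eta_phi (qs _)) oppr0.
Qed.

Lemma hor_phi i X : hor X -> hor (phi i X).
Proof.
move=> hX; have ijk := cyclic_tripleP i; set j := i + 1 in ijk *.
set k := j + 1 in ijk *; have jki := cyclic_triple_rot ijk.
have kij := cyclic_triple_rot jki.
apply: (cyclic_triple_ind ijk); first exact: (eta_phi (qs _)).
  have [_ _ _ _ H] := three_relations ijk.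
  by have := H X; rewrite hX => /esym/eqP; rewrite oppr_eq0 => /eqP.
have [_ _ _ H _] := three_relations kij.
by rewrite -H hX.
Qed.

Lemma horD X Y : hor X -> hor Y -> hor (X + Y).
Proof. by move=> hX hY i; rewrite linearD /= hX hY addr0. Qed.

Lemma horZ f X : hor X -> hor (f *: X).
Proof. by move=> hX i; rewrite linearZ /= hX mulr0. Qed.

Definition hpart X : vfield M := X - \sum_i eta i X *: xi i.

Lemma hpartE i j k X : cyclic_triple i j k ->
  X = hpart X + (eta i X *: xi i + eta j X *: xi j + eta k X *: xi k).
Proof. by move=> ijk; rewrite /hpart (cyclic_triple_sum _ ijk) subrK. Qed.

Lemma hor_hpart X : hor (hpart X).
Proof.
move=> i; have ijk := cyclic_tripleP i; set j := i + 1 in ijk *.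
set k := j + 1 in ijk *; have jki := cyclic_triple_rot ijk.
have kij := cyclic_triple_rot jki.
rewrite /hpart linearB (cyclic_triple_sum _ ijk) !linearD !linearZ /=.
rewrite (eta_xi (qs _)) (eta_xi_orth ijk).1 (eta_xi_orth kij).2.
by rewrite !mulr0 mulr1 !addr0 subrr.
Qed.

Lemma eta_nabla i X Y : eta i Y = 0 -> eta i (nabla X Y) = - w i X Y.
Proof.
move=> Y0; have := lieder_eta hnabla (qs i) X Y; rewrite Y0 lieder0.
by move=> /esym/eqP; rewrite addr_eq0 => /eqP.
Qed.

Lemma cov_deriv_hor i X Y : hor Y ->
  cov_deriv nabla (phi i) X Y = - (a i X Y *: xi i).
Proof.
by move=> hY; rewrite (cov_derivE_shape hnabla (qs i)) hY scale0r sub0r.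
Qed.

(** Differentiate [phi_k Y = phi_i (phi_j Y) - eta_j(Y) xi_i] covariantly: for horizontal [Y] all
    terms are vertical, and the two claims are the components along [xi_k] and [xi_i]. *)
Lemma vorticity_phi_hor_eq i j k X Y : cyclic_triple i j k -> hor Y ->
  a j X Y = a k X Y /\ w j X Y = - a i X (phi j Y).
Proof.
move=> ijk hY; have jki := cyclic_triple_rot ijk.
have kij := cyclic_triple_rot jki.
have [E _ [Exi _] _ _] := three_relations ijk.
have : cov_deriv nabla (phi k) X Y = cov_deriv nabla (phi i) X (phi j Y)
    + phi i (cov_deriv nabla (phi j) X Y) - w j X Y *: xi i.
  rewrite /cov_deriv !E hY scale0r subr0 linearB /= eta_nabla//.
  rewrite scaleNr opprK linearB /=.
  apply: (metric_nondegenerate (g := g)) => Z; apply: sfunP => p.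
  rewrite !metricE !sfunE; lra.
rewrite !cov_deriv_hor//; last exact: hor_phi.
rewrite [phi i (- _)]linearN [phi i (_ *: _)]linearZ /= -Exi => H.
split; apply: sfunP => p.
- have := congr1 (fun X => g X (xi k) p) H.
  rewrite !metricE -!(etaE (qs _)) (eta_xi (qs _)) (eta_xi_orth kij).1 !sfunE.
  lra.
- have := congr1 (fun X => g X (xi i) p) H.
  rewrite !metricE -!(etaE (qs _)) (eta_xi (qs _)) (eta_xi_orth kij).2 !sfunE.
  lra.
Qed.

Lemma vorticity_phi_hor i j X Y : hor Y -> a i X Y = a j X Y.
Proof.
move=> hY; have ijk := cyclic_tripleP i; move: j.
have jki := cyclic_triple_rot ijk; have kij := cyclic_triple_rot jki.
apply: (cyclic_triple_ind ijk) => //.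
  by rewrite (vorticity_phi_hor_eq _ kij hY).1.
by rewrite -(vorticity_phi_hor_eq _ jki hY).1.
Qed.

(** The forms [a_i] and [a_j] agree when the second argument is horizontal, so the index can be
    changed to [j], where [nabla_{xi_j} xi_j = 0]. *)
Lemma vorticity_xi_hor i j Y : hor Y -> w i (xi j) Y = 0.
Proof.
move=> hY; rewrite -[w i _ _]opprK -(vorticity_phi2r hnabla (qs i)).
rewrite -/(vorticity_phi _ _ _ _ _ _) (vorticity_phi_hor i j); last exact: hor_phi.
by rewrite /vorticity_phi (vorticity_xil hnabla (qs j)) oppr0.
Qed.

Lemma vorticity_phi_xi_hor i j Y : hor Y -> a i (xi j) Y = 0.
Proof. by move=> hY; apply/vorticity_xi_hor/hor_phi. Qed.

(** Here the constant [c] enters: only the component of [U] along [xi k] matters, and [d eta_j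
    (xi_i, xi_k) = - eta_j [xi_i, xi_k] = c]. *)
Lemma vorticity_xi i j k U : cyclic_triple i j k ->
  w j (xi i) U + w j (xi i) U = smooth_cst M c * eta k U.
Proof.
move=> ijk; have jki := cyclic_triple_rot ijk; have kij := cyclic_triple_rot jki.
have e : w j (xi i) U = eta k U * w j (xi i) (xi k).
  have := hpartE U ijk; move: (hpart U) (hor_hpart U) => H hH EU.
  rewrite {1}EU !(vorticityE hnabla) vorticity_xi_hor//.
  rewrite (vorticity_xir hnabla (qs j)).
  have -> : w j (xi i) (xi i) = 0.
    apply: sfunP => p; have := vorticity_skew hnabla (qs j) (xi i) (xi i).
    move/(congr1 (fun f : C => f p)); rewrite !sfunE; lra.
  by rewrite !mulr0 !add0r.
rewrite e -mulrDr mulrC; congr (_ * _).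
rewrite -(d1_eta hnabla (qs j)) /d1 (eta_xi_orth ijk).2 (eta_xi_orth jki).1.
rewrite -!/(lieder _ _) !lieder0 subrr sub0r lie_bracket_skew.
rewrite (bracket_xi kij) linearN linearZ /= (eta_xi (qs j)) mulr1.
by rewrite opprK.
Qed.

Lemma shape_hor i j Y : hor Y -> A i Y = A j Y.
Proof.
move=> hY; apply: (metric_nondegenerate (g := g)) => Z.
rewrite !(shapeE (qs _)) !(vorticity_phi_sym hnabla (qs _) Y).
exact: vorticity_phi_hor.
Qed.

Lemma hor_shape i Y : hor Y -> hor (A i Y).
Proof.
move=> hY j; rewrite (etaE (qs j)) (shapeE (qs i)).
by rewrite (vorticity_phi_sym hnabla (qs i)) vorticity_phi_xi_hor.
Qed.

(** On horizontal fields [w_j(Y, Z) = - w_i(Y, phi_k Z)]; along [xi_i] the form [w_i] is parallel,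
    and so is [phi_k] on horizontal fields. *)
Lemma cov_vorticity_xi_hor i j k Y Z : cyclic_triple i j k -> hor Y -> hor Z ->
  cov_vorticity (g := g) (nabla := nabla) (xi := xi j) (xi i) Y Z = 0.
Proof.
move=> ijk hY hZ; have jki := cyclic_triple_rot ijk.
have kij := cyclic_triple_rot jki.
have [E _ _ _ _] := three_relations ijk.
have e U V : hor V -> w j U V = - w i U (phi k V).
  move=> hV; rewrite (vorticity_phi_hor_eq _ ijk hV).2 /vorticity_phi.
  by rewrite E hV scale0r subr0.
have hn V : hor V -> hor (nabla (xi i) V).
  by move=> hV l; rewrite eta_nabla// vorticity_xi_hor// oppr0.
have := cov_vorticity_xi hnabla (qs i) Y (phi k Z).
rewrite /cov_vorticity !e//; last exact: hn.
have -> : nabla (xi i) (phi k Z) = phi k (nabla (xi i) Z).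
  apply/eqP; rewrite -subr_eq0 -/(cov_deriv _ _ _ _) cov_deriv_hor//.
  by rewrite vorticity_phi_xi_hor// scale0r oppr0.
rewrite liederN => /(congr1 (fun f : C => f _)) H; apply: sfunP => p.
by move: (H p); rewrite !sfunE; lra.
Qed.

Lemma metric_shape_shape i Y Z : hor Y -> hor Z ->
  g (A i Y) (A i Z) = smooth_cst M (- c / 2) * a i Y Z.
Proof.
(* Closedness of [d eta_j] at [(xi_m, Y', Z')]: the derivative along [xi_m] vanishes, and each of
   the other two gives a term with [c] and a term quadratic in [A]. *)
have main m j k Y' Z' : cyclic_triple m j k -> hor Y' -> hor Z' ->
    g (A k Z') (phi k (A k Y')) = smooth_cst M (- c / 2) * w k Y' Z'.
  move=> mjk hY hZ; have jkm := cyclic_triple_rot mjk.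
  have kmj := cyclic_triple_rot jkm.
  have := cov_vorticity_cyclic hnabla (qs j) (xi m) Y' Z'.
  rewrite (cov_vorticity_xi_hor mjk)// add0r.
  have v U : w j U (xi m) = - w j (xi m) U by apply: vorticity_skew.
  rewrite /cov_vorticity !v (vorticity_xi_hor j m hY).
  rewrite (vorticity_xi_hor j m hZ) oppr0 !lieder0.
  (* On horizontal fields [phi_j phi_m = - phi_k], so both quadratic terms are the same product. *)
  have e1 : w j Z' (nabla Y' (xi m)) = g (A k Z') (phi k (A k Y')).
    rewrite /vorticity -(phi_shape hnabla (qs j)) -(phi_shape hnabla (qs m)).
    rewrite (phi_skew (qs j)) (shape_hor j k hZ) (shape_hor m k hY).
    have [_ -> _ _ _] := three_relations mjk.
    by rewrite (hor_shape k hY) scale0r addr0 metricNr.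
  have e2 : w j (nabla Z' (xi m)) Y' = g (A k Z') (phi k (A k Y')).
    rewrite (vorticity_skew hnabla (qs j)) /vorticity.
    rewrite -(phi_shape hnabla (qs j)) -(phi_shape hnabla (qs m)).
    rewrite (phi_skew (qs j)) (shape_hor j k hY) (shape_hor m k hZ).
    have [_ E _ _ _] := three_relations mjk.
    have := E (A k Z'); rewrite (hor_shape k hZ) scale0r addr0 => e.
    have -> : phi j (phi m (A k Z')) = - phi k (A k Z') by rewrite e opprK.
    by rewrite opprK metricNr -(phi_skew (qs k)) metricC.
  rewrite e1 e2.
  (* For horizontal fields [eta_k(nabla_{Y'} Z') = - w_k(Y', Z')], which turns the terms with [c]
     into multiples of [w_k]. *)
  have t1 := vorticity_xi (nabla Y' Z') mjk.
  have t2 := vorticity_xi (nabla Z' Y') mjk.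
  rewrite !eta_nabla// (vorticity_skew hnabla (qs k) Z') in t1 t2.
  move=> H; apply: sfunP => p.
  have := congr1 (fun f : C => f p) H.
  have := congr1 (fun f : C => f p) t1.
  have := congr1 (fun f : C => f p) t2.
  rewrite !sfunE; lra.
move=> hY hZ; have ijk := cyclic_tripleP i.
(* Taking [phi i Y] for [Y'] turns [w_i] into [a_i] and absorbs the outer [phi i]. *)
have := main _ _ _ (phi i Y) Z (cyclic_triple_rot ijk) (hor_phi i hY) hZ.
rewrite (shape_phi hnabla (qs i)) (phi2 (qs i)) (hor_shape i hY).
rewrite scale0r addr0 metricNr metricC.
have -> : w i (phi i Y) Z = - a i Y Z.
  by rewrite /vorticity_phi (vorticity_phir hnabla (qs i)) opprK.
by rewrite mulrN => /oppr_inj.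
Qed.

(** With the index switched to [j] this is the skew form [w_j] on twice the same field. *)
Lemma vorticity_phi_orth i j X : hor X -> a i (phi j X) X = 0.
Proof.
move=> hX; rewrite (vorticity_phi_hor i j _ hX) /vorticity_phi.
apply: sfunP => p; have := vorticity_skew hnabla (qs j) (phi j X) (phi j X).
move/(congr1 (fun f : C => f p)); rewrite !sfunE; lra.
Qed.

(* With [phi_i = phi_j phi_k], commuting [phi_j] with the curvature turns
   [R(X, phi_i X) phi_i X, X] into a mixed term, and the three mixed terms
   cancel by the Bianchi identity. *)
Lemma sum_phi_sectional l X p : hor X ->
  \sum_i phi_sectional_curvature g nabla (phi i) X p = 3 * a l X X p ^+ 2.
Proof.
move=> hX.
have H i j k : cyclic_triple i j k -> phi_sectional_curvature g nabla (phi i) X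
    = riemann (g := g) (nabla := nabla) X (phi i X) (phi j X) (phi k X)
      + a l X X ^+ 2.
  move=> ijk; have jki := cyclic_triple_rot ijk.
  have kij := cyclic_triple_rot jki.
  have [E _ _ _ _] := three_relations jki.
  have e : phi j (phi k X) = phi i X by rewrite E hX scale0r subr0.
  have hk := hor_phi k hX.
  have := riemann_phi hnabla (qs j) X (phi i X) (hk j) (hX j).
  rewrite e -/(phi_sectional_curvature _ _ _ _).
  rewrite (riemann_skewr hnabla X _ (phi k X)).
  rewrite (vorticity_phi_orth j i hX).
  have -> : w j (phi i X) (phi k X) = - a l X X.
    rewrite (vorticity_phi_hor_eq _ ijk hk).2 e.
    by rewrite (vorticity_phi_phi_phi hnabla (qs i)) (vorticity_phi_hor i l _ hX).
  have -> : w j X X = 0.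
    apply: sfunP => q; have := vorticity_skew hnabla (qs j) X X.
    move/(congr1 (fun f : C => f q)); rewrite !sfunE; lra.
  have -> : a j X (phi k X) = 0.
    by rewrite (vorticity_phi_sym hnabla (qs j)) vorticity_phi_orth.
  rewrite (vorticity_phi_hor j l _ hX).
  move/(congr1 (fun f : C => f _)) => H; apply: sfunP => q; move: (H q).
  rewrite expr2 !sfunE; lra.
have ijk := cyclic_tripleP l; set j := l + 1 in ijk *; set k := j + 1 in ijk *.
have jki := cyclic_triple_rot ijk; have kij := cyclic_triple_rot jki.
rewrite (cyclic_triple_sum _ ijk) (H _ _ _ ijk) (H _ _ _ jki) (H _ _ _ kij).
(* Pair symmetry puts [X] last, so that the three mixed terms become the rotations in one Bianchi
   sum. *)
have T U V W : riemann (g := g) (nabla := nabla) X U V W =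
    - riemann (g := g) (nabla := nabla) V W U X.
  by rewrite (riemann_sym hnabla) (riemann_skewr hnabla).
rewrite !T; have := riemann_bianchi hnabla (phi l X) (phi j X) (phi k X) X.
move/(congr1 (fun f : C => f p)); rewrite !expr2 !sfunE; lra.
Qed.

End ThreeQuasiSasakian.

(** * The quadratic equation of the shape operator *)

Section ShapeOperator.
Context {R : realType} {d : nat} {M : manifold R d} {g : metric M}.
Context {nabla : vfield M -> vfield M -> vfield M}.
Hypothesis hnabla : levi_civita g nabla.
Context {phi : 'I_3 -> endo M} {xi : 'I_3 -> vfield M}
  {eta : 'I_3 -> one_form M} {c : R}.
Hypothesis h3qs : three_quasi_sasakian g phi xi eta.
Hypothesis hc : for_even_perms (fun a b k =>
  lie_bracket (xi a) (xi b) = smooth_cst M c *: xi k).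
Local Notation C := (smooth_fun M).
Implicit Types (X Y Z W : vfield M) (f : C) (i j : 'I_3).
Local Notation w i := (vorticity g nabla (xi i)).
Local Notation a i := (vorticity_phi g nabla (phi i) (xi i)).
Local Notation A i := (shape nabla (phi i) (xi i)).
Local Notation hor := (hor (eta := eta)).
Local Notation hpart := (hpart (xi := xi) (eta := eta)).

Let qs i : quasi_sasakian g (phi i) (xi i) (eta i).
Proof. by case: h3qs. Qed.

Lemma shape_linear i f X Y : A i (f *: X + Y) = f *: A i X + A i Y.
Proof.
rewrite /shape (nablaDl hnabla) (nablaZl hnabla) linearD linearZ /=.
by rewrite opprD scalerN.
Qed.

(** Against horizontal fields this is [metric_shape_shape]; against each [xi j] both sides vanish
    because [A i] preserves horizontal fields. *)
Lemma shape_shape i X : hor X -> A i (A i X) = smooth_cst M (- c / 2) *: A i X.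
Proof.
move=> hX; have hAX := hor_shape hnabla h3qs i hX.
have hAAX := hor_shape hnabla h3qs i hAX.
apply: (metric_nondegenerate (g := g)) => W.
have := hpartE (xi := xi) (eta := eta) W (cyclic_tripleP i).
move: (hpart W) (hor_hpart h3qs W) => H hH ->.
have e j Y : hor Y -> g Y (xi j) = 0 by move=> hY; rewrite -(etaE (qs j)).
rewrite metricZl !metricDr !metricZr !(e _ _ hAX) !(e _ _ hAAX) !mulr0 !addr0.
rewrite (shapeE (qs i)) (vorticity_phi_sym hnabla (qs i)) -(shapeE (qs i)).
rewrite (metric_shape_shape hnabla h3qs hc)//.
by rewrite (vorticity_phi_sym hnabla (qs i)) -(shapeE (qs i)).
Qed.

End ShapeOperator.

(** * Vanishing of vector fields at a point *)

Section Vanishing.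
Context {R : realType} {d : nat} {M : manifold R d}.
Local Notation C := (smooth_fun M).
Implicit Types (X Y Z W : vfield M) (f : C).

(* For vector fields, vanishing at [p] means being a combination of vector
   fields with coefficients vanishing at [p]; testing with all functionals
   linear over smooth functions avoids naming that combination. *)
Definition vanishes (p : M) X : Prop := forall L : vfield M -> C,
  (forall f Y Z, L (f *: Y + Z) = f * L Y + L Z) -> L X p = 0.

Lemma vanishesD p X Y : vanishes p X -> vanishes p Y -> vanishes p (X + Y).
Proof.
move=> X0 Y0 L hL; rewrite -[X]scale1r hL mul1r !sfunE.
by rewrite X0// Y0// addr0.
Qed.

Lemma vanishesZ p f X : f p = 0 -> vanishes p (f *: X).
Proof.
move=> f0 L hL; have L0 : L 0 = 0.
  apply: (addrI (L 0)); rewrite addr0 -[in RHS](addr0 0) -[X in X + 0]scale1r.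
  by rewrite hL mul1r.
by rewrite -[f *: X]addr0 hL L0 addr0 sfunM f0 mul0r.
Qed.

Lemma vanishes_endo p (phi : endo M) X : vanishes p X -> vanishes p (phi X).
Proof.
by move=> X0 L hL; apply: (X0 (L \o phi)) => f Y Z; rewrite /= linearP hL.
Qed.

Lemma vanishes_metric p (g : metric M) Y X : vanishes p X -> g X Y p = 0.
Proof.
by move=> X0; apply: (X0 (g^~ Y)) => f Z W; rewrite metricDl metricZl.
Qed.

Lemma riemann_vanishes p (g : metric M) nabla X Y Z W V V1 V2 V3 :
  levi_civita g nabla ->
  vanishes p V -> vanishes p V1 -> vanishes p V2 -> vanishes p V3 ->
  riemann (g := g) (nabla := nabla) (X + V) (Y + V1) (Z + V2) (W + V3) p =
  riemann (g := g) (nabla := nabla) X Y Z W p.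
Proof.
move=> hnabla V0 V10 V20 V30.
rewrite (riemannDl hnabla) sfunD.
rewrite (V0 (fun V => riemann (g := g) (nabla := nabla) V _ _ _)); last first.
  by move=> *; rewrite (riemannDl hnabla) (riemannZl hnabla).
rewrite addr0 (riemannDm hnabla) sfunD.
rewrite (V10 (fun V => riemann (g := g) (nabla := nabla) _ V _ _)); last first.
  by move=> *; rewrite (riemannDm hnabla) (riemannZm hnabla).
rewrite addr0 (riemannDn hnabla) sfunD.
rewrite (V20 (fun V => riemann (g := g) (nabla := nabla) _ _ V _)); last first.
  by move=> *; rewrite (riemannDn hnabla) (riemannZn hnabla).
rewrite addr0 riemannDr sfunD.
rewrite (V30 (fun V => riemann (g := g) (nabla := nabla) _ _ _ V)); last first.
  by move=> *; rewrite riemannDr riemannZr.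
by rewrite addr0.
Qed.

End Vanishing.

(** * Passage to pointwise horizontality, and the projection onto [E^4l] *)

Section SumOfCurvatures.
Context {R : realType} {d : nat} {M : manifold R d} {g : metric M}.
Context {nabla : vfield M -> vfield M -> vfield M}.
Hypothesis hnabla : levi_civita g nabla.
Context {phi : 'I_3 -> endo M} {xi : 'I_3 -> vfield M}
  {eta : 'I_3 -> one_form M} {c : R}.
Hypothesis h3qs : three_quasi_sasakian g phi xi eta.
Hypothesis hc : for_even_perms (fun a b k =>
  lie_bracket (xi a) (xi b) = smooth_cst M c *: xi k).
Local Notation C := (smooth_fun M).
Implicit Types (X Y Z W : vfield M) (f : C) (i j : 'I_3) (p : M).
Local Notation w i := (vorticity g nabla (xi i)).
Local Notation a := (vorticity_phi g nabla (phi ord0) (xi ord0)).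
Local Notation A := (shape nabla (phi ord0) (xi ord0)).
Local Notation hor := (hor (eta := eta)).
Local Notation hp := (hpart (xi := xi) (eta := eta)).
Local Notation E4l := (dist_E4l g xi eta).
Local Notation E4m := (dist_E4m eta).

Let qs i : quasi_sasakian g (phi i) (xi i) (eta i).
Proof. by case: h3qs. Qed.

(** The difference is the sum of the [eta i X *: xi i], whose coefficients vanish at [p]. *)
Lemma sub_hpart_vanishes X p : horizontal eta p X -> vanishes p (X - hp X).
Proof.
move=> hX; rewrite /hpart opprB addrC subrK.
by elim/big_ind: _ => [|U V U0 V0|i _];
  [rewrite -(scale0r 0); apply: vanishesZ|exact: vanishesD|exact/vanishesZ/hX].
Qed.

Lemma metric_hpart X Y p : horizontal eta p X -> g X Y p = g (hp X) Y p.
Proof.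
move=> /sub_hpart_vanishes /(vanishes_metric g Y).
by rewrite metricDl metricNl !sfunE => /eqP; rewrite subr_eq0 => /eqP.
Qed.

Lemma sum_phi_sectional_at X p : horizontal eta p X ->
  \sum_i phi_sectional_curvature g nabla (phi i) X p =
  3 * a (hp X) (hp X) p ^+ 2.
Proof.
move=> hX; rewrite -(sum_phi_sectional hnabla h3qs ord0 p (hor_hpart h3qs X)).
apply: eq_bigr => i _; have V := sub_hpart_vanishes hX.
have Vi := vanishes_endo (phi i) V.
have := riemann_vanishes (hp X) (phi i (hp X)) (phi i (hp X)) (hp X)
  hnabla V Vi Vi V.
by rewrite -linearD subrKC.
Qed.

Lemma shape_eq0_E4m Y p : hor Y -> A Y = 0 -> E4m p Y.
Proof.
move=> hY AY; split => [i|i Z]; first by rewrite hY.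
rewrite (d1_eta hnabla (qs i)) /vorticity -(phi_shape hnabla (qs i)).
by rewrite (shape_hor hnabla h3qs i ord0 hY) AY linear0 metric0l addr0.
Qed.

Lemma E4m_vorticity_phi Y Z p : E4m p Y -> a Y Z p = 0.
Proof.
move=> [_ /(_ ord0 (phi ord0 Z))]; rewrite (d1_eta hnabla (qs _)) sfunD.
by rewrite /vorticity_phi; lra.
Qed.

(* Since [A^2 = -(c/2) A] on horizontal vectors, [-(2/c) A] is a projection. *)
Definition E4m_part X := hp X + smooth_cst M (2 / c) *: A (hp X).
Definition E4l_part X := smooth_cst M (- (2 / c)) *: A (hp X).

(** [A + (2/c) A^2 = 0] on horizontal fields. *)
Lemma E4m_part_E4m X p : c != 0 -> E4m p (E4m_part X).
Proof.
move=> c0; have hX := hor_hpart h3qs X; apply: shape_eq0_E4m.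
  by apply: horD => //; apply/horZ/(hor_shape hnabla h3qs).
rewrite /E4m_part addrC (shape_linear hnabla) (shape_shape hnabla h3qs hc)//.
rewrite scalerA -[X in _ + X]scale1r -scalerDl.
rewrite (_ : _ + _ = 0) ?scale0r//; apply: sfunP => q; rewrite !sfunE.
by field.
Qed.

Lemma E4lP X p : E4l p X ->
  horizontal eta p X /\ forall Y, E4m p Y -> g X Y p = 0.
Proof.
move=> [XE XV]; split => // i; rewrite (etaE (qs i)); apply: XV.
(* Kronecker deltas exhibit [xi i] in the fibre of [vertical]. *)
exists (fun j => (j == i)%:R) => f; congr (lieder _ f p).
rewrite (bigD1 i) //= big1 => [|j /negPf ->]; last first.
  by rewrite (_ : smooth_cst M _ = 0) ?scale0r//; exact: sfunP.
by rewrite eqxx (_ : smooth_cst M _ = 1) ?scale1r ?addr0//; exact: sfunP.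
Qed.

(** At [p] the field is orthogonal to [E4m_part X], which reads [0 = g(X, X) + (2/c) a(X, X)]. *)
Lemma E4l_vorticity_phi X p : c != 0 -> E4l p X -> g X X p = 1 ->
  a (hp X) (hp X) p = - (c / 2).
Proof.
move=> c0 /E4lP[hX /(_ _ (E4m_part_E4m X p c0))].
rewrite metric_hpart// metricDr metricZr (metricC _ _ (A _)) (shapeE (qs _)).
move=> e; rewrite metric_hpart// metricC metric_hpart// => e1.
move: e; rewrite !sfunE e1 => e.
have : c / 2 * (1 + 2 / c * a (hp X) (hp X) p) = 0 by rewrite e mulr0.
rewrite mulrDr mulrA (_ : c / 2 * (2 / c) = 1); last by field.
by rewrite mul1r mulr1 => /eqP; rewrite addrC addr_eq0 => /eqP.
Qed.

(** [|A X|^2] is [-(c/2) a(X, X)], so [A X = 0]. *)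
Lemma vorticity_phi_c0 X : c = 0 -> hor X -> a X X = 0.
Proof.
move=> c0 hX; rewrite -(shapeE (qs _)) (_ : A X = 0) ?metric0l//.
apply: (metric_eq0 (g := g)) => p; rewrite (metric_shape_shape hnabla h3qs hc)//.
by rewrite c0 oppr0 mul0r sfunM mul0r.
Qed.

Hypothesis same_at_vanishes : forall p X, same_at p X 0 -> vanishes p X.

(** Membership in [vertical] prescribes only the derivation at [p]; [same_at_vanishes] is what makes
    the metric depend on that derivation alone. *)
Lemma perp_vertical p X : horizontal eta p X -> perp g (vertical xi) p X.
Proof.
move=> hX Y [v Yv]; set S := \sum__ _ in Yv.
have V : vanishes p (Y - S).
  apply: same_at_vanishes => f; apply/eqP.
  by rewrite -[X in X == _]/(lieder Y f p - lieder S f p) subr_eq0; apply/eqP/Yv.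
have := vanishes_metric g X V; rewrite metricDl metricNl metric_suml.
rewrite !sfunE sfun_sum big1 => [|i _].
  by rewrite subr0 metricC.
by rewrite metricZl sfunM metricC -(etaE (qs i)) hX mulr0.
Qed.

Lemma E4l_part_E4l X p : E4l p (E4l_part X).
Proof.
have hX := hor_hpart h3qs X.
split; last first.
  by apply: perp_vertical => i; rewrite (horZ _ (hor_shape hnabla h3qs _ hX)).
move=> Z Zm; rewrite metricZl (shapeE (qs _)) (vorticity_phi_sym hnabla (qs _)).
by rewrite sfunM E4m_vorticity_phi ?mulr0.
Qed.

Lemma orth_proj_E4l X : c != 0 -> orth_proj g E4l X = E4l_part X.
Proof.
move=> c0; have P1 p : E4l p (E4l_part X) by exact: E4l_part_E4l.
have P2 p : perp g E4l p (X - E4l_part X).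
  move=> Z /[dup] ZE /E4lP[hZ Zm].
  (* A vertical field plus a section of [E^4m]; elements of [E^4l] are orthogonal to both. *)
  have e : X - E4l_part X = X - hp X + E4m_part X.
    rewrite /E4l_part /E4m_part; move: (A (hp X)) (hp X) => U V.
    apply: (metric_nondegenerate (g := g)) => W; apply: sfunP => q.
    rewrite !metricE !sfunE; lra.
  rewrite e metricDl sfunD metricC [g (E4m_part X) Z]metricC.
  rewrite (Zm _ (E4m_part_E4m X p c0)) addr0 /hpart opprB addrC subrK.
  rewrite metricC metric_suml sfun_sum big1// => i _.
  by rewrite metricZl sfunM metricC -(etaE (qs i)) hZ mulr0.
apply: xget_unique; first by split=> p _; [exact: P1|exact: P2].
(* Uniqueness: the difference of two candidates lies in [E^4l] and is orthogonal to it, so it has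
   length zero. *)
move=> Q [Q1 Q2]; apply/eqP; rewrite -subr_eq0; apply/eqP.
apply: (metric_eq0 (g := g)) => p.
have QP : E4l p (Q - E4l_part X).
  have [a1 a2] := Q1 p I; have [b1 b2] := P1 p.
  split=> Y hY; rewrite metricDl metricNl !sfunE.
    by rewrite (a1 _ hY) (b1 _ hY) subrr.
  by rewrite (a2 _ hY) (b2 _ hY) subrr.
have := Q2 p I _ QP; have := P2 p _ QP.
rewrite !metricE !sfunE; lra.
Qed.

End SumOfCurvatures.

(** * Smooth maps and bump functions *)

Section DirectionalDerivatives.
Context {R : realType}.
Implicit Types (V W : normedModType R).

Lemma derivable_line V W (f : V -> W) (b v : V) (s : R) :
  derivable f (b + s *: v) v -> derivable (fun t : R => f (b + t *: v)) s 1.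
Proof.
rewrite /derivable; set F := fun _ => _; set G := fun _ => _.
suff -> : F = G by [].
by apply/funext => h; rewrite /F /G /= scalerDl [h *: 1]mulr1 addrCA.
Qed.

Lemma derive_line V W (f : V -> W) (b v : V) (s : R) :
  'D_1 (fun t : R => f (b + t *: v)) s = 'D_v f (b + s *: v).
Proof.
rewrite /derive; set F := fun _ => _; set G := fun _ => _.
suff -> : F = G by [].
by apply/funext => h; rewrite /F /G /= scalerDl [h *: 1]mulr1 addrCA.
Qed.

Lemma derivable_of_line V W (f : V -> W) (b v : V) :
  derivable (fun t : R => f (b + t *: v)) 0 1 -> derivable f b v.
Proof.
rewrite /derivable; set F := fun _ => _; set G := fun _ => _.
suff -> : F = G by [].
by apply/funext => h; rewrite /F /G /= scale0r !addr0 [h *: 1]mulr1 [b + _]addrC.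
Qed.

Lemma mean_value_line V (f : V -> R) (b v : V) (u : R) :
  (forall s : R, `|s| <= `|u| -> derivable f (b + s *: v) v) ->
  exists2 s, `|s| <= `|u| & f (b + u *: v) - f b = u * 'D_v f (b + s *: v).
Proof.
move=> df; pose h (t : R) := f (b + t *: v).
have hd (s : R) : `|s| <= `|u| -> is_derive s 1 h ('D_v f (b + s *: v)).
  by move=> /df/derivable_line/derivableP; rewrite derive_line.
have h0 : h 0 = f b by rewrite /h scale0r addr0.
have hc (i : interval R) : (forall s, s \in i -> `|s| <= `|u|) ->
    {within [set` i], continuous h}.
  move=> iu; apply: derivable_within_continuous => s /iu su.
  exact: (@ex_derive _ _ _ _ _ _ _ (hd s su)).
have [u0|u0] := leP 0 u.
  have su s : s \in `[0, u]%R -> `|s| <= `|u|.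
    by rewrite in_itv /= => /andP[s0 su]; rewrite !ger0_norm.
  have [s /su su' e] := @MVT_segment _ h (fun s => 'D_v f (b + s *: v)) _ _ u0
    (fun s si => hd s (su _ (subset_itv_oo_cc si))) (hc _ su).
  by exists s => //; rewrite -h0 -/(h u) e subr0 mulrC.
have su s : s \in `[u, 0]%R -> `|s| <= `|u|.
  by rewrite in_itv /= => /andP[s0 su]; rewrite !ler0_norm ?lerN2// ltW.
have [s /su su' e] := @MVT_segment _ h (fun s => 'D_v f (b + s *: v)) _ _ (ltW u0)
  (fun s si => hd s (su _ (subset_itv_oo_cc si))) (hc _ su).
by exists s => //; rewrite -h0 -/(h u) -opprB e sub0r mulrN opprK mulrC.
Qed.

Lemma norm_coord_le n (v : 'rV[R]_n) i : `|v 0 i| <= `|v|.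
Proof.
rewrite [leRHS]/Num.norm /= mx_normrE.
by apply/bigmax_geP; right; exists (0, i).
Qed.

Lemma norm_rV_le n (v : 'rV[R]_n) e :
  0 <= e -> (forall i, `|v 0 i| <= e) -> `|v| <= e.
Proof.
move=> e0 ve; rewrite [leLHS]/Num.norm /= mx_normrE.
by apply/bigmax_leP; split=> // -[i j] _ /=; rewrite ord1.
Qed.

Lemma continuous_rV (T : topologicalType) n (f : T -> 'rV[R]_n) x :
  (forall i, {for x, continuous (fun y => f y 0 i)}) -> {for x, continuous f}.
Proof.
move=> fc; apply/cvgrPdist_le => e e0.
have : \forall y \near x, forall i, `|f x 0 i - f y 0 i| <= e.
  by apply: filter_forall => i; have /cvgrPdist_le/(_ _ e0) := fc i.
apply: filterS => y fy; apply: norm_rV_le (ltW e0) _ => i.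
by rewrite !mxE; exact: fy.
Qed.

(* [f z - f z0] as a telescoping sum along the coordinate directions *)
Lemma mean_value_coord n (f : 'rV[R]_n -> R) (z0 z : 'rV[R]_n) :
  (forall i y, `|y - z0| <= `|z - z0| -> derivable f y 'e_i) ->
  exists2 c : 'I_n -> 'rV[R]_n, forall i, `|c i - z0| <= `|z - z0| &
    f z - f z0 = \sum_i (z 0 i - z0 0 i) * 'D_'e_i f (c i).
Proof.
move=> df.
(* The first [m] coordinates come from [z], the others from [z0]; as the norm is the sup norm, the
   whole path stays within distance [|z - z0|] of [z0]. *)
pose q m : 'rV[R]_n := \row_i if (i < m)%N then z 0 i else z0 0 i.
have qS (i : 'I_n) : q i.+1 = q i + (z 0 i - z0 0 i) *: 'e_i.
  apply/rowP => j; rewrite !mxE ltnS leq_eqVlt eqxx /=.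
  have [->|ji] := eqVneq j i; first by rewrite eqxx ltnn /= mulr1 addrC subrK.
  by rewrite val_eqE (negPf ji) /= mulr0 addr0.
have qle (i : 'I_n) (s : R) : `|s| <= `|z 0 i - z0 0 i| ->
    `|q i + s *: 'e_i - z0| <= `|z - z0|.
  move=> sle; apply: norm_rV_le => // j; rewrite !mxE eqxx /=.
  have zj k : `|z 0 k - z0 0 k| <= `|z - z0|.
    by have := norm_coord_le (z - z0) k; rewrite !mxE.
  have [->|ji] := eqVneq j i.
    by rewrite ltnn mulr1 addrAC subrr add0r (le_trans sle).
  by rewrite mulr0 addr0; case: ifP => _ //; rewrite subrr normr0.
have /choice[s sP] (i : 'I_n) : exists s,
    `|q i + s *: 'e_i - z0| <= `|z - z0| /\
    f (q i.+1) - f (q i) = (z 0 i - z0 0 i) * 'D_'e_i f (q i + s *: 'e_i).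
  have [s s1 s2] := @mean_value_line _ f (q i) 'e_i (z 0 i - z0 0 i)
    (fun s sle => df i _ (qle i s sle)).
  by exists s; split; [exact: qle|rewrite qS].
exists (fun i : 'I_n => q i + s i *: 'e_i) => [i|]; first by have [] := sP i.
have zE : z = q n by apply/rowP => i; rewrite mxE ltn_ord.
have z0E : z0 = q 0 by apply/rowP => i; rewrite mxE ltn0.
transitivity (\sum_(i < n) (f (q i.+1) - f (q i))).
  rewrite -(big_mkord xpredT (fun i => f (q i.+1) - f (q i))).
  by rewrite telescope_sumr// -zE -z0E.
by apply: eq_bigr => i _; have [] := sP i.
Qed.

End DirectionalDerivatives.

Section ChainRule.
Context {R : realType}.
Implicit Types (V W : normedModType R).

Lemma is_derive_cvg V W (f : V -> W) (x v : V) (l : W) :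
  h^-1 *: (f (h *: v + x) - f x) @[h --> 0^'] --> l -> is_derive x v f l.
Proof.
move=> fl; split; first by apply/cvg_ex; exists l.
exact: cvg_lim fl.
Qed.

Lemma cvg_sum_seq (T : Type) (F : set_system T) (I : Type) (r : seq I)
    (f : I -> T -> R) (l : I -> R) : Filter F ->
  (forall i, f i t @[t --> F] --> l i) ->
  \sum_(i <- r) f i t @[t --> F] --> \sum_(i <- r) l i.
Proof.
move=> FF fl; elim: r => [|i r IH].
  rewrite big_nil; under eq_cvg do rewrite big_nil; exact: cvg_cst.
rewrite big_cons; under eq_cvg do rewrite big_cons; exact: cvgD.
Qed.

(** A chain rule from continuous partial derivatives alone: the increment is telescoped along the
    coordinates, with intermediate points that tend to [c 0]. *)
Lemma is_derive_curve n (f : 'rV[R]_n -> R) (O : set 'rV[R]_n)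
    (c : R -> 'rV[R]_n) (dc : 'I_n -> R) :
  open O -> O (c 0) -> (forall i y, O y -> derivable f y 'e_i) ->
  (forall i, {for c 0, continuous ('D_'e_i f)}) ->
  (forall i, is_derive (0 : R) (1 : R) (fun t => c t 0 i) (dc i)) ->
  is_derive (0 : R) (1 : R) (f \o c) (\sum_i dc i * 'D_'e_i f (c 0)).
Proof.
move=> oO Oc df Dc dcP.
have cc : {for 0, continuous c}.
  apply: continuous_rV => i; apply/differentiable_continuous/derivable1_diffP.
  exact: (@ex_derive _ _ _ _ _ _ _ (dcP i)).
have cc' : c @ 0^' --> c 0 by apply: cvg_trans cc; exact/cvg_app/nbhs_dnbhs.
have /nbhs_ballP[r /= r0 rO] : nbhs (c 0) O by exact: open_nbhs_nbhs.
have /choice[C CP] (t : R) : exists C : 'I_n -> 'rV[R]_n,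
    ball (c 0) r (c t) -> (forall i, `|C i - c 0| <= `|c t - c 0|) /\
    f (c t) - f (c 0) = \sum_i (c t 0 i - c 0 0 i) * 'D_'e_i f (C i).
  (* A default value, not met for [t] near [0]. *)
  have [ct|nct] := pselect (ball (c 0) r (c t)); last by exists (fun=> 0).
  have [|C C1 C2] := @mean_value_coord _ _ f (c 0) (c t); last by exists C.
  move=> i y ylt; apply/df/rO; rewrite -ball_normE /= distrC.
  by apply: le_lt_trans ylt _; rewrite distrC; move: ct; rewrite -ball_normE.
have near_r : \forall t \near 0^', ball (c 0) r (c t).
  by apply: (cc' (ball (c 0) r)); exact: nbhsx_ballx.
have CC i : C t i @[t --> 0^'] --> c 0.
  apply/cvgrPdist_lt => e e0; near=> t.
  have [|C1 _] := CP t; first by near: t.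
  rewrite distrC (le_lt_trans (C1 i))// distrC.
  by near: t; move/cvgrPdist_lt : cc' => /(_ _ e0).
apply: is_derive_cvg.
have key : \sum_(i <- index_enum 'I_n) (h^-1 * (c h 0 i - c 0 0 i)) *
    'D_'e_i f (C h i) @[h --> 0^'] --> \sum_i dc i * 'D_'e_i f (c 0).
  apply: cvg_sum_seq => i; apply: cvgM; last first.
    exact: (cvg_comp (C^~ i) ('D_'e_i f) (CC i) (Dc i)).
  have [dv e] := dcP i; rewrite -e.
  have : (fun h : R => h^-1 *: (c (h *: 1 + 0) 0 i - c 0 0 i)) =
      (fun h => h^-1 * (c h 0 i - c 0 0 i)).
    by apply/funext => h; rewrite [h *: 1]mulr1 addr0.
  by move=> <-; exact: dv.
apply: cvg_trans key; apply: near_eq_cvg; near=> h => /=.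
have [|_ ->] := CP (h *: 1 + 0).
  by rewrite [_ *: 1]mulr1 addr0; near: h.
by rewrite scaler_sumr; apply: eq_bigr => i _; rewrite [h *: 1]mulr1 addr0 -mulrA.
Unshelve. all: by end_near. Qed.

End ChainRule.

Section SmoothMaps.
Context {R : realType}.
Implicit Types (V W : normedModType R).

Lemma is_derive_line V W (f : V -> W) (b v : V) (l : W) :
  is_derive (0 : R) (1 : R) (fun t : R => f (b + t *: v)) l -> is_derive b v f l.
Proof.
move=> [dl e]; split; first exact: derivable_of_line.
by rewrite -e derive_line scale0r addr0.
Qed.

Lemma is_derive_on_line V W (f : V -> W) (b v : V) :
  derivable f b v ->
  is_derive (0 : R) (1 : R) (fun t : R => f (b + t *: v)) ('D_v f b).
Proof.
move=> df; have := @derive_line _ _ _ f b v 0; rewrite scale0r addr0 => <-.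
by apply/derivableP/derivable_line; rewrite scale0r addr0.
Qed.

Lemma Ck_sub V W k (U U' : set V) (f : V -> W) :
  U `<=` U' -> Ck k U' f -> Ck k U f.
Proof.
move=> UU'; elim: k f => [|k IH] f /= [fc fk]; first by split=> // x /UU'/fc.
split=> [x /UU'/fc//|]; case: fk => fd fD.
by split=> [x v /UU' Ux|v]; [exact: fd|exact/IH/fD].
Qed.

Lemma Ck_local V W k (U : set V) (f : V -> W) :
  (forall x, U x -> exists O (h : V -> W),
    [/\ open O, O x, forall y, O y -> h y = f y & Ck k O h]) -> Ck k U f.
Proof.
elim: k f => [|k IH] f floc.
all: have near_f x O (h : V -> W) :
  open O -> O x -> (forall y, O y -> h y = f y) -> {near x, h =1 f} by
  move=> oO Ox hf; apply: filterS (open_nbhs_nbhs (conj oO Ox)).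
all: have fc x : U x -> {for x, continuous f} by
  move=> /floc[] O [h [oO Ox hf hk]];
  apply: near_continuous (near_f _ _ _ oO Ox hf) (Ck_continuous hk Ox).
- by split.
- split => //; split => [x v|v].
    move=> /floc[] O [h [oO Ox hf [_ [hd _]]]].
    exact: near_eq_derivable (near_f _ _ _ oO Ox hf) (hd _ _ Ox).
  apply: IH => x /floc[] O [h [oO Ox hf [_ [_ hD]]]].
  exists O, ('D_v h); split=> [//|//|y Oy|]; last exact: hD.
  exact/near_eq_derive/(near_f _ _ _ oO Oy hf).
Qed.

Lemma Ck_opp V W k (U : set V) (f : V -> W) :
  open U -> Ck k U f -> Ck k U (- f).
Proof.
move=> oU; elim: k f => [|k IH] f [fc fk].
all: split; first by move=> x Ux; apply: continuousN; exact: fc.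
- by [].
case: fk => fd fD; split=> [x v Ux|v]; first by apply: derivableN; exact: fd.
by apply: (Ck_ext oU _ (IH _ (fD v))) => x Ux; rewrite deriveN//; exact: fd.
Qed.

Lemma Ck_sum V k (U : set V) (I : Type) (r : seq I) (f : I -> V -> R) :
  open U -> (forall i, Ck k U (f i)) -> Ck k U (fun x => \sum_(i <- r) f i x).
Proof.
move=> oU fk; elim: r => [|i r IH].
  by apply: (Ck_ext oU _ (Ck_cst k U 0)) => x _; rewrite big_nil.
apply: (Ck_ext oU _ (Ck_add oU (fk i) IH)) => x _.
by rewrite big_cons.
Qed.

Lemma derivable_rV V n (f : V -> 'rV[R]_n) x v i : derivable f x v ->
  is_derive x v (fun y => f y 0 i) ('D_v f x 0 i).
Proof.
move=> df; apply: is_derive_cvg.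
have := cvg_comp _ _ df (@coord_continuous R 1 n 0 i _).
apply: cvg_trans; apply: near_eq_cvg; near=> h.
by rewrite /= !mxE.
Unshelve. all: by end_near. Qed.

Lemma Ck_coord V n k (U : set V) (f : V -> 'rV[R]_n) i : open U ->
  Ck k U f -> Ck k U (fun x => f x 0 i).
Proof.
move=> oU; elim: k f => [|k IH] f [fc fk].
all: have gc x : U x -> {for x, continuous (fun y => f y 0 i)}.
1,3: by move=> Ux; apply: (@continuous_comp _ _ _ f (fun N : 'rV[R]_n => N 0 i));
  [exact: fc|exact: coord_continuous].
- by split.
case: fk => fd fD; split => //; split=> [x v Ux|v].
  exact: (@ex_derive _ _ _ _ _ _ _ (derivable_rV i (fd x v Ux))).
apply: (Ck_ext oU _ (IH _ (fD v))) => x Ux.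
by have [_ ->] := derivable_rV i (fd x v Ux).
Qed.

(** The chain rule writes each derivative as a sum of products of functions of class [k - 1], so
    induction on [k] applies. *)
Lemma Ck_comp V n k (U : set V) (O : set 'rV[R]_n) (f : 'rV[R]_n -> R)
    (h : V -> 'rV[R]_n) :
  open U -> open O -> (forall x, U x -> O (h x)) -> Ck k O f ->
  (forall i, Ck k U (fun x => h x 0 i)) -> Ck k U (f \o h).
Proof.
move=> oU oO UO; elim: k f => [|k IH] f fk hk.
all: have cc x : U x -> {for x, continuous (f \o h)}.
1,3: move=> Ux; apply: continuous_comp; last exact: (Ck_continuous fk (UO x Ux));
  by apply: continuous_rV => i; exact: (Ck_continuous (hk i) Ux).
- by split.
case: (fk) => _ [fd fD].
have dP x v : U x -> is_derive x v (f \o h)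
    (\sum_i 'D_v (fun x => h x 0 i) x * 'D_'e_i f (h x)).
  move=> Ux; apply: is_derive_line.
  have := @is_derive_curve _ n f O (fun t => h (x + t *: v))
    (fun i => 'D_v (fun x => h x 0 i) x) oO.
  rewrite scale0r addr0; apply; first exact: UO.
  - by move=> i y Oy; exact: fd.
  - by move=> i; exact: (Ck_continuous (fD 'e_i) (UO x Ux)).
  - move=> i; apply: (is_derive_on_line (f := fun x => h x 0 i)).
    by have [_ [hd _]] := hk i; exact: hd.
split=> //; split=> [x v Ux|v]; first exact: (@ex_derive _ _ _ _ _ _ _ (dP x v Ux)).
apply: (Ck_ext oU
  (f := fun x => \sum_i 'D_v (fun x => h x 0 i) x * 'D_'e_i f (h x))).
  by move=> x Ux; have [_ ->] := dP x v Ux.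
apply: Ck_sum => // i; apply: Ck_mul => //; first by have [_ [_]] := hk i; exact.
exact: IH (fD 'e_i) (fun j => Ck_pred (hk j)).
Qed.

Lemma Ck_id n k (U : set 'rV[R]_n) i : Ck k U (fun x => x 0 i).
Proof.
have dP (x v : 'rV[R]_n) : is_derive x v (fun y : 'rV[R]_n => y 0 i) (v 0 i).
  have := @derivable_rV _ _ id x v i (@derivable_id _ _ x v).
  by rewrite derive_id.
have cc (x : 'rV[R]_n) : {for x, continuous (fun y : 'rV[R]_n => y 0 i)}.
  exact: coord_continuous.
case: k => [|k]; split=> //; split=> [x v _|v].
  exact: (@ex_derive _ _ _ _ _ _ _ (dP x v)).
rewrite (_ : 'D_v _ = cst (v 0 i)); first exact: Ck_cst.
by apply/funext => x; have [_ ->] := dP x v.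
Qed.

Lemma is_derive_comp_scalar V (f : R -> R) (h : V -> R) x v (l dh : R) :
  is_derive (h x) (1 : R) f l -> is_derive x v h dh ->
  is_derive x v (f \o h) (dh * l).
Proof.
move=> [fd fl] [hd <-]; apply: is_derive_line.
pose c t := h (x + t *: v).
have c0 : c 0 = h x by rewrite /c scale0r addr0.
have [cd ce] := is_derive_on_line hd.
have fd0 : derivable f (c 0) 1 by rewrite c0; exact: fd.
have dcf : derivable (f \o c) 0 1.
  apply/derivable1_diffP/differentiable_comp; first exact/derivable1_diffP.
  exact/derivable1_diffP/fd0.
split; first exact: dcf.
have := derive1_comp cd fd0; rewrite !derive1E => ->.
by rewrite ce scale0r addr0 fl mulrC.
Qed.

Lemma Ck_comp_scalar V k (U : set V) (f : R -> R) (h : V -> R) :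
  open U -> Ck k setT f -> Ck k U h -> Ck k U (f \o h).
Proof.
move=> oU; elim: k f => [|k IH] f fk hk.
all: have cc x : U x -> {for x, continuous (f \o h)}.
1,3: by move=> Ux; apply: continuous_comp; [exact: (Ck_continuous hk Ux)|
  exact: (Ck_continuous fk)].
- by split.
case: (fk) (hk) => _ [fd fD] [_ [hd hD]].
have dP x v : U x -> is_derive x v (f \o h) ('D_v h x * 'D_1 f (h x)).
  by move=> Ux; apply: is_derive_comp_scalar; apply/derivableP; [exact: fd|exact: hd].
split=> //; split=> [x v Ux|v]; first exact: (@ex_derive _ _ _ _ _ _ _ (dP x v Ux)).
apply: (Ck_ext oU (f := 'D_v h * ('D_1 f \o h))).
  by move=> x Ux; have [_ ->] := dP x v Ux.
apply: Ck_mul => //; [exact: hD|exact: IH (fD 1) (Ck_pred hk)].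
Qed.

End SmoothMaps.

(** * Bump functions *)

Section Bump.
Context {R : realType}.

(** The powers of [t^-1] make the family stable: each derivative is a combination of later members,
    so smoothness follows by induction. *)
Definition flat (n : nat) (t : R) : R :=
  if 0 < t then t^-1 ^+ n * expR (- t^-1) else 0.

(** For [t > 0], use [exp s >= s^(n+2) / (n+2)!] at [s = 1/t]. Being quadratic in [t], the bound
    forces a zero derivative at the origin. *)
Lemma flat_le n t : `|flat n t| <= n.+2`!%:R * t ^+ 2.
Proof.
rewrite /flat; case: ifPn => [t0|_]; last by rewrite normr0 mulr_ge0// sqr_ge0.
have s0 : 0 < t^-1 by rewrite invr_gt0.
rewrite ger0_norm; last by rewrite mulr_ge0 ?expR_ge0// exprn_ge0 ?ltW.
have e1 : t^-1 ^+ n.+2 / n.+2`!%:R <= expR t^-1.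
  by apply: le_trans (expR_ge1Dxn n.+1 (ltW s0)); rewrite lerDr.
rewrite expRN ler_pdivrMr ?expR_gt0//.
have f0 : 0 < n.+2`!%:R :> R by rewrite ltr0n fact_gt0.
rewrite ler_pdivrMr// in e1.
have -> : t^-1 ^+ n = t ^+ 2 * t^-1 ^+ n.+2.
  have e : t ^+ 2 * t^-1 ^+ 2 = 1 by rewrite -exprMn divff ?gt_eqF// expr1n.
  by rewrite -(addn2 n) exprD [RHS]mulrCA e mulr1.
rewrite [leRHS](_ : _ = t ^+ 2 * (expR t^-1 * n.+2`!%:R)); last by ring.
by rewrite ler_wpM2l ?sqr_ge0.
Qed.

Lemma is_derive_flat n (t : R) :
  is_derive t (1 : R) (flat n) (flat n.+2 t - n%:R * flat n.+1 t).
Proof.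
have [t0|t0|t0] := ltgtP t 0.
- have -> : flat n.+2 t - n%:R * flat n.+1 t = 0.
    by rewrite /flat !ltNge (ltW t0) /= mulr0 subrr.
  apply: (@near_eq_is_derive _ _ _ (cst 0)).
    near=> s; rewrite /flat ifF//; apply/negbTE; rewrite -leNgt ltW//.
    by near: s; exact: lt_nbhsl.
- have E : is_derive t (1 : R)
      ((fun s => s ^+ n * expR (- s)) \o (fun t : R => t^-1))
      (flat n.+2 t - n%:R * flat n.+1 t).
    have d1 : is_derive t (1 : R) (fun t : R => t^-1) (- t^-1 ^+ 2).
      have tn0 : (id t : R) != 0 by rewrite gt_eqF.
      have dt := @derivable_id _ R t (1 : R).
      split; first exact: (@derivableV _ _ id t 1 tn0 dt).
      rewrite (@deriveV _ _ id t 1 tn0 dt) derive_id.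
      by rewrite [_ *: 1]mulr1 exprVn.
    have d2 s : is_derive s (1 : R) (fun s => s ^+ n * expR (- s))
        (n%:R * s ^+ n.-1 * expR (- s) - s ^+ n * expR (- s)).
      have dE : is_derive s (1 : R) (fun s : R => expR (- s)) (- expR (- s)).
        have := is_derive_comp_scalar (is_derive_expR (- s)) (is_deriveNid s 1).
        by rewrite mulN1r.
      have dX : is_derive s (1 : R) (fun s : R => s ^+ n) (n%:R * s ^+ n.-1).
        split; first exact: exprn_derivable.
        by rewrite exp_derive [_ *: 1]mulr1.
      have := is_deriveM dX dE; rewrite -![_ *: _]/(_ * _).
      by move/is_derive_eq; apply; ring.
    have := is_derive_comp_scalar (d2 t^-1) d1; move/is_derive_eq; apply.
    rewrite /flat t0; move: (t^-1) => s; move: (expR (- s)) => E.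
    by case: n {d2} => [|n] /=; rewrite ?mul0r ?expr0 ?exprS; ring.
  apply: (near_eq_is_derive _ E).
  near=> s; rewrite /flat ifT//.
  by near: s; exact: lt_nbhsr.
- have f0 m : flat m 0 = 0 by rewrite /flat ltxx.
  rewrite t0 !f0 mulr0 subrr; apply: is_derive_cvg.
  apply/cvgr0Pnorm_le => /= e e0; near=> h.
  rewrite [h *: 1]mulr1 addr0 f0 subr0 normrM.
  have h0 : h != 0 by near: h; exact: nbhs_dnbhs_neq.
  apply: le_trans (ler_wpM2l (normr_ge0 _) (flat_le n h)) _.
  have -> : `|h^-1| * (n.+2`!%:R * h ^+ 2) = n.+2`!%:R * `|h|.
    have hn : `|h| != 0 by rewrite normr_eq0.
    by rewrite -[h ^+ 2]real_normK ?num_real// normfV; field.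
  rewrite -ler_pdivlMl ?ltr0n ?fact_gt0//.
  near: h; apply: dnbhs0_le.
  by rewrite mulr_gt0// invr_gt0 ltr0n fact_gt0.
Unshelve. all: by end_near. Qed.

Lemma Ck_flat k n (U : set R) : Ck k U (flat n).
Proof.
apply: (@Ck_sub _ _ _ k U setT) => //.
elim: k n => [|k IH] n; split.
1,3: move=> t _; apply/differentiable_continuous/derivable1_diffP;
  exact: (@ex_derive _ _ _ _ _ _ _ (is_derive_flat n t)).
- by [].
have D1 t : 'D_1 (flat n) t = flat n.+2 t - n%:R * flat n.+1 t.
  by have [_ ->] := is_derive_flat n t.
(* [Ck] asks for derivatives in every direction, and a direction in [R] is an arbitrary scalar. *)
have dP (t v : R) : is_derive t v (flat n) (v * 'D_1 (flat n) t).
  apply: is_derive_line; have d0 : is_derive (0 : R) (1 : R)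
      (fun s => t + s *: v) v.
    have := is_deriveD (is_derive_cst t (0 : R) (1 : R))
      (is_deriveZ v (is_derive_id (0 : R) (1 : R))).
    by rewrite add0r [v *: 1]mulr1; congr (is_derive _ _ _ _);
      apply/funext => s; congr (_ + _); exact: mulrC.
  have dt : is_derive (t + 0 *: v) (1 : R) (flat n) ('D_1 (flat n) t).
    rewrite scale0r addr0; apply/derivableP.
    exact: (@ex_derive _ _ _ _ _ _ _ (is_derive_flat n t)).
  exact: (@is_derive_comp_scalar _ _ (flat n) (fun s : R => t + s *: v)
    _ _ _ _ dt d0).
split=> [t v _|v]; first exact: (@ex_derive _ _ _ _ _ _ _ (dP t v)).
apply: (Ck_ext openT (f := cst v * (flat n.+2 + cst (- n%:R) * flat n.+1))).
  by move=> t _; have [_ ->] := dP t v; rewrite D1 -mulNr.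
apply: Ck_mul; [exact: openT|exact: Ck_cst|].
apply: Ck_add; [exact: openT|exact: IH|].
by apply: Ck_mul; [exact: openT|exact: Ck_cst|exact: IH].
Qed.

Lemma compact_closed_ball_rV n (x : 'rV[R]_n) (r : R) : 0 < r ->
  compact (closed_ball x r).
Proof.
move=> r0; apply: bounded_closed_compact; last exact: closed_ball_closed.
exists (`|x| + r); split; first exact: num_real.
move=> m ltm y; rewrite closed_ballE//= => yr.
apply: le_trans (ltW ltm); have := ler_normD x (y - x).
by rewrite subrKC => /le_trans; apply; rewrite lerD2l distrC.
Qed.

Lemma bump_exists n (U : set 'rV[R]_n) (y0 : 'rV[R]_n) : open U -> U y0 ->
  exists b : 'rV[R]_n -> R, exists K : set 'rV[R]_n,
    [/\ smooth_on setT b, b y0 != 0, compact K, K `<=` U &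
        forall y, ~ K y -> b y = 0].
Proof.
move=> oU Uy0; have /nbhs_ballP[r' /= r'0 rU] : nbhs y0 U.
  exact: open_nbhs_nbhs.
(* Half the radius keeps the closed ball inside the open one. *)
pose r := r' / 2; have r0 : 0 < r by rewrite divr_gt0.
(* Sums of squares are smooth, unlike the sup norm; [q y < r ^ 2] bounds each coordinate difference
   by [r], so the bump is zero off the closed sup-norm ball. *)
pose q (y : 'rV[R]_n) := \sum_i (y 0 i - y0 0 i) ^+ 2.
have Ck_q k : Ck k setT q.
  apply: Ck_sum => [|i]; first exact: openT.
  have Ck_i : Ck k setT ((fun y : 'rV[R]_n => y 0 i) + cst (- y0 0 i)).
    by apply: Ck_add; [exact: openT|exact: Ck_id|exact: Ck_cst].
  exact: (Ck_mul openT Ck_i Ck_i).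
exists (fun y => flat 0 (r ^+ 2 - q y)), (closed_ball y0 r); split.
- move=> k; apply: (Ck_comp_scalar (f := flat 0) openT); first exact: Ck_flat.
  apply: (Ck_add openT (f := cst (r ^+ 2)) (g := - q)); first exact: Ck_cst.
  by apply: Ck_opp; [exact: openT|exact: Ck_q].
- have -> : q y0 = 0 by rewrite /q big1// => i _; rewrite subrr expr0n.
  by rewrite /flat subr0 exprn_gt0// expr0 mul1r gt_eqF ?expR_gt0.
- exact: compact_closed_ball_rV.
- move=> y; rewrite closed_ballE// => yr; apply: rU; rewrite -ball_normE /=.
  by apply: le_lt_trans yr _; rewrite /r ltr_pdivrMr// mulr2n mulrDr mulr1 ltrDl.
- move=> y nK; rewrite /flat ifF//; apply: contra_notF nK.
  rewrite subr_gt0 closed_ballE// => qr; rewrite /closed_ball_ /= distrC.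
  apply: norm_rV_le => [|i]; first exact: ltW.
  rewrite !mxE -(ler_pXn2r (n := 2))// ?nnegrE ?(ltW r0)//.
  rewrite real_normK ?num_real//; apply: le_trans (ltW qr).
  by rewrite /q (bigD1 i)//= lerDl sumr_ge0// => j _; exact: sqr_ge0.
Qed.

End Bump.

Lemma open_setI_preimage (S T : topologicalType) (U : set S) (f : S -> T)
  (O : set T) : open U -> (forall x, U x -> {for x, continuous f}) -> open O ->
  open (U `&` f @^-1` O).
Proof.
move=> oU fc oO; rewrite openE => x [Ux Ofx]; apply: filterI.
  exact: open_nbhs_nbhs.
exact/fc/open_nbhs_nbhs.
Qed.

Section BumpMultiples.
Context {R : realType} {d : nat}.

Lemma smooth_bump_mul (b u : 'rV[R]_d -> R) (K U : set 'rV[R]_d) :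
  smooth_on setT b -> (forall y, ~ K y -> b y = 0) -> closed K -> open U ->
  K `<=` U -> smooth_on U u -> smooth_on setT (b * u).
Proof.
move=> sb b0 cK oU KU su k; apply: Ck_local => y _.
have [Ky|nKy] := pselect (K y).
  exists U, (b * u); split=> //; first exact: KU.
  by apply: Ck_mul => //; exact: Ck_sub (sb k).
exists (~` K), (cst 0); split=> //; first exact: closed_openC.
  by move=> z nKz; rewrite /= -[RHS]/(b z * u z) b0// mul0r.
exact: Ck_cst.
Qed.

End BumpMultiples.

(** * Extension by zero from a chart *)

Section ExtensionByZero.
Context {R : realType} {d : nat} {M : manifold R d}.
Context (k : chart R d M) (K : set 'rV[R]_d).
Hypothesis atlas_k : atlas k.
Hypothesis compact_K : compact K.
Hypothesis K_img : K `<=` chart_img k.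

Definition ext0 (u : 'rV[R]_d -> R) : M -> R :=
  fun x => if `[< chart_dom k x >] then u (chart_map k x) else 0.

Lemma ext0_dom u x : chart_dom k x -> ext0 u x = u (chart_map k x).
Proof. by rewrite /ext0 => /asboolT ->. Qed.

Lemma ext0_Ndom u x : ~ chart_dom k x -> ext0 u x = 0.
Proof. by rewrite /ext0 => /asboolF ->. Qed.

(** Compactness of [K] and the Hausdorff property make this set closed in [M], not merely in the
    chart domain. *)
Lemma closed_chart_inv_image : closed (chart_inv k @` K).
Proof.
apply: compact_closed; first exact: manifold_hausdorff.
apply: continuous_compact => //; apply: continuous_in_subspaceT => y.
by rewrite inE => /K_img; exact: chart_inv_continuous.
Qed.

(** Every point has a neighbourhood in the chart domain, where [ext0 u] is [u] after a transition
    map, or off the closed image of [K], where it is zero. *)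
Lemma ext0_smooth u : smooth_on (chart_img k) u ->
  (forall y, ~ K y -> u y = 0) -> ext0 u \in smooth_pred (M := M).
Proof.
move=> su u0; apply/asboolP => k2 atlas_k2 n; apply: Ck_local => y y2.
have oi2 : open (chart_img k2) := @chart_img_open _ _ _ k2.
have ci2 y1 : chart_img k2 y1 -> {for y1, continuous (chart_inv k2)} :=
  @chart_inv_continuous _ _ _ _ y1.
have [yk|yNk] := pselect (chart_dom k (chart_inv k2 y)).
  exists (chart_img k2 `&` chart_inv k2 @^-1` chart_dom k).
  exists (u \o (chart_map k \o chart_inv k2)).
  have oO : open (chart_img k2 `&` chart_inv k2 @^-1` chart_dom k).
    by apply: open_setI_preimage => //; exact: (@chart_dom_open _ _ _ k).
  split=> // [z [z2 zk]|]; first by rewrite /= ext0_dom.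
  apply: (Ck_comp (O := chart_img k)) => //.
  - exact: (@chart_img_open _ _ _ k).
  - by move=> z [_ zk]; have [] := chart_mapK zk.
  - by move=> i; apply: Ck_coord => //; exact: atlas_compat.
exists (chart_img k2 `&` chart_inv k2 @^-1` ~` (chart_inv k @` K)), (cst 0).
split.
- apply: open_setI_preimage => //.
  exact/closed_openC/closed_chart_inv_image.
- split=> //= -[q Kq qy]; apply: yNk; rewrite -qy.
  by have [] := chart_invK (K_img Kq).
- move=> z [z2 zK] /=; have [zk|zNk] := pselect (chart_dom k (chart_inv k2 z)).
    rewrite ext0_dom// u0// => Kz; apply: zK.
    exists (chart_map k (chart_inv k2 z)) => //.
    by have [] := chart_mapK zk.
  by rewrite ext0_Ndom.
- exact: Ck_cst.
Qed.

End ExtensionByZero.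

(** * The Hadamard lemma *)

Section UnitIntervalIntegral.
Context {R : realType}.
Implicit Types (f F : R -> R).

Definition int01 f : R := (\int[@lebesgue_measure R]_(t in `[0%R, 1%R]) f t)%R.

Lemma integrable01 f : continuous f ->
  (@lebesgue_measure R).-integrable `[0%R, 1%R] (EFin \o f).
Proof.
move=> cf; apply: continuous_compact_integrable; first exact: segment_compact.
exact: continuous_subspaceT.
Qed.

Lemma int01_derive f F : continuous f ->
  (forall t : R, is_derive t (1 : R) F (f t)) -> int01 f = F 1 - F 0.
Proof.
move=> cf dF.
have cF : continuous F.
  move=> t; apply/differentiable_continuous/derivable1_diffP.
  exact: (@ex_derive _ _ _ _ _ _ _ (dF t)).
rewrite /int01 /Rintegral (@continuous_FTC2 _ f F) //.
- exact: continuous_subspaceT.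
- split.
  + by move=> t _; exact: (@ex_derive _ _ _ _ _ _ _ (dF t)).
  + exact/cvg_at_right_filter/cF.
  + exact/cvg_at_left_filter/cF.
- by move=> t _; rewrite derive1E; have [_ ->] := dF t.
Qed.

Lemma int01_cst (c : R) : int01 (fun=> c) = c.
Proof.
have dF (t : R) : is_derive t (1 : R) (c \*: id) c.
  by have := is_deriveZ c (is_derive_id t (1 : R)); rewrite [c *: 1]mulr1.
rewrite (@int01_derive (fun=> c) _ (@cst_continuous _ _ c) dF).
by rewrite /= [c *: 1]mulr1 scaler0 subr0.
Qed.

Lemma int01_le f (c : R) : continuous f ->
  (forall t, 0 <= t <= 1 -> `|f t| <= c) -> `|int01 f| <= c.
Proof.
move=> cf fc.
have cnf : continuous (fun t => `|f t|).
  by move=> t; apply: (@continuous_comp _ _ _ f); [exact: cf|exact: norm_continuous].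
have h : `|int01 f| <= int01 (fun t => `|f t|).
  by apply: le_normr_Rintegral => //; exact: integrable01.
apply: (le_trans h); rewrite -[leRHS]int01_cst.
apply: le_Rintegral => //; first exact: integrable01.
  exact/integrable01/cst_continuous.
Qed.

Lemma int01D f F : continuous f -> continuous F ->
  int01 (fun t => f t + F t) = int01 f + int01 F.
Proof. by move=> cf cF; apply: RintegralD => //; exact: integrable01. Qed.

Lemma int01B f F : continuous f -> continuous F ->
  int01 (fun t => f t - F t) = int01 f - int01 F.
Proof. by move=> cf cF; apply: RintegralB => //; exact: integrable01. Qed.

Lemma int01Zl (r : R) f : continuous f ->
  int01 (fun t => r * f t) = r * int01 f.
Proof. by move=> cf; apply: RintegralZl => //; exact: integrable01. Qed.

Lemma int01_sum (I : Type) (r : seq I) (f : I -> R -> R) :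
  (forall i, continuous (f i)) ->
  int01 (fun t => \sum_(i <- r) f i t) = \sum_(i <- r) int01 (f i).
Proof.
move=> cf; elim: r => [|i r IH].
  rewrite big_nil (_ : (fun=> _) = (fun t => 0 * (cst 0 : R -> R) t)).
    by rewrite int01Zl ?mul0r//; exact: cst_continuous.
  by apply/funext => t; rewrite big_nil mul0r.
have cs : continuous (fun t => \sum_(j <- r) f j t).
  move=> t; apply: cvg_sum_seq => j; exact: cf.
rewrite big_cons -IH -int01D//.
by congr int01; apply/funext => t; rewrite big_cons.
Qed.

End UnitIntervalIntegral.

Section Hadamard.
Context {R : realType} {n : nat}.
Implicit Types (u : 'rV[R]_n -> R) (q y v z : 'rV[R]_n).

Definition ray q y (t : R) : 'rV[R]_n := q + t *: (y - q).

(** Differentiation in [y] under the integral brings out a factor [t]; the weights [t ^+ j] make the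
    family stable under it. *)
Definition ray_int (j : nat) u q y : R := int01 (fun t => t ^+ j * u (ray q y t)).

Lemma continuous_ray u q y : (forall z v, derivable u z v) ->
  continuous (fun t : R => u (ray q y t)).
Proof.
move=> du t; apply/differentiable_continuous/derivable1_diffP.
exact/derivable_line.
Qed.

Lemma continuous_ray_weight j u q y : (forall z v, derivable u z v) ->
  continuous (fun t : R => t ^+ j * u (ray q y t)).
Proof.
move=> du t; apply: cvgM; last exact: continuous_ray.
exact: exprn_continuous.
Qed.

Lemma bounded_on_ball u q (r : R) : continuous u -> 0 < r ->
  exists2 C, 0 <= C & forall z, `|z - q| <= r -> `|u z| <= C.
Proof.
move=> uc r0; have cK : compact (closed_ball q r) := compact_closed_ball_rV r0.
have nuc : {within closed_ball q r, continuous (fun z => `|u z|)}.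
  apply: continuous_subspaceT => z.
  by apply: (@continuous_comp _ _ _ u); [exact: uc|exact: norm_continuous].
have [|c _ cP] := EVT_max_rV _ cK nuc.
  by exists q; rewrite closed_ballE// /closed_ball_ /= subrr normr0 ltW.
exists `|u c| => // z zr; apply: cP.
by rewrite inE closed_ballE// /closed_ball_ /= distrC.
Qed.

Lemma ray_ball q y t : 0 <= t <= 1 -> `|ray q y t - q| <= `|y - q|.
Proof.
move=> /andP[t0 t1]; rewrite /ray addrAC subrr add0r normrZ ger0_norm//.
by rewrite ler_piMl.
Qed.

Lemma continuous_Pdist (T : topologicalType) (f : T -> R) (x : T) :
  (forall e, 0 < e -> \forall y \near x, `|f x - f y| <= e) ->
  {for x, continuous f}.
Proof. by move=> fx; apply/cvgrPdist_le. Qed.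

Lemma near_dist (x : 'rV[R]_n) (e : R) : 0 < e ->
  \forall y \near x, `|x - y| <= e.
Proof. by move=> e0; move: (@cvg_id _ (nbhs x)) => /cvgrPdist_le; apply. Qed.

Lemma continuous_ray_int j u q : (forall z v, derivable u z v) ->
  (forall v, continuous ('D_v u)) -> continuous (ray_int j u q).
Proof.
move=> du Du y0.
have r0 : 0 < `|y0 - q| + 1 by rewrite ltr_wpDl.
have /choice[C /all_and2[C0 CP]] (i : 'I_n) : exists C, 0 <= C /\
    forall z, `|z - q| <= `|y0 - q| + 1 -> `|'D_'e_i u z| <= C.
  by have [C C0 CP] := bounded_on_ball q (Du 'e_i) r0; exists C.
(* A Lipschitz constant from bounds on the partial derivatives; the [1] makes it positive, for the
   division. *)
pose S := 1 + \sum_i C i.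
have S0 : 0 < S by rewrite ltr_pwDl// sumr_ge0.
suff main (e : R) : 0 < e ->
    \forall y \near y0, `|ray_int j u q y0 - ray_int j u q y| <= e.
  exact: continuous_Pdist main.
move=> e0; have : \forall y \near y0, `|y0 - y| <= Num.min 1 (e / S).
  by apply: near_dist; rewrite lt_min ltr01 divr_gt0.
apply: filterS => y; rewrite le_min => /andP[y1 ye].
rewrite /ray_int -int01B; [|exact: continuous_ray_weight..].
apply: int01_le => [t|t t01].
  by apply: cvgB; exact: continuous_ray_weight.
rewrite -mulrBr normrM; have /andP[t0 t1] := t01.
apply: (@le_trans _ _ `|u (ray q y0 t) - u (ray q y t)|).
  by rewrite ler_piMl// normrX ger0_norm// exprn_ile1.
have zz : `|ray q y t - ray q y0 t| <= `|y0 - y|.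
  rewrite /ray opprD addrACA subrr add0r -scalerBr opprB addrA subrK normrZ.
  by rewrite ger0_norm// distrC ler_piMl.
rewrite distrC; have [c cP ->] := @mean_value_coord _ _ u (ray q y0 t) (ray q y t)
  (fun i z _ => du z 'e_i).
apply: le_trans (ler_norm_sum _ _ _) _.
apply: (@le_trans _ _ (\sum_i `|y0 - y| * C i)).
  apply: ler_sum => i _; rewrite normrM ler_pM//.
    apply: le_trans zz; have := norm_coord_le (ray q y t - ray q y0 t) i.
    by rewrite !mxE.
  apply: CP; have := ler_normD (ray q y0 t - q) (c i - ray q y0 t).
  rewrite addrC addrA subrK => /le_trans; apply; apply: lerD.
    exact: ray_ball.
  exact: le_trans (le_trans (cP i) zz) y1.
rewrite -mulr_sumr.
apply: (@le_trans _ _ (e / S * S)); last by rewrite divfK ?gt_eqF.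
by rewrite ler_pM// ?sumr_ge0// lerDr.
Qed.

End Hadamard.

Section HadamardLemma.
Context {R : realType} {n : nat}.
Implicit Types (u : 'rV[R]_n -> R) (q y v z : 'rV[R]_n).

Lemma ray_add_line q y v (s t : R) :
  ray q (y + s *: v) t = ray q y t + (s * t) *: v.
Proof.
by rewrite /ray [y + _ - q]addrAC scalerDr scalerA addrA [t * s]mulrC.
Qed.

Lemma is_derive_weighted_ray j u q y v (s t : R) : (forall z, derivable u z v) ->
  is_derive s (1 : R) (fun s => t ^+ j * u (ray q (y + s *: v) t))
    (t ^+ j.+1 * 'D_v u (ray q (y + s *: v) t)).
Proof.
move=> du; pose h (r : R) := u (ray q y t + r *: v).
have dh : is_derive (s * t) (1 : R) h ('D_v u (ray q (y + s *: v) t)).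
  rewrite ray_add_line -derive_line; apply/derivableP/derivable_line/du.
have dm : is_derive s (1 : R) (fun s : R => s * t) t.
  have := is_deriveZ t (is_derive_id s (1 : R)); rewrite [t *: 1]mulr1.
  by congr (is_derive _ _ _ _); apply/funext => r; exact: mulrC.
have := is_deriveZ (t ^+ j)
  (@is_derive_comp_scalar _ _ h (fun s : R => s * t) s 1 _ _ dh dm).
rewrite exprSr -mulrA; congr (is_derive _ _ _ _).
by apply/funext => r; rewrite ray_add_line.
Qed.

Lemma is_derive_ray_int j u q y v : (forall z v, derivable u z v) ->
  (forall v, continuous ('D_v u)) ->
  is_derive y v (ray_int j u q) (ray_int j.+1 ('D_v u) q y).
Proof.
move=> du Du; apply: is_derive_line.
pose f (s t : R) := t ^+ j * u (ray q (y + s *: v) t).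
(* For [s] in []-1, 1[] the segments from [q] to [y + s *: v] stay in the ball of this radius, so a
   constant dominates the differentiated integrand. *)
have r0 : 0 < `|y - q| + `|v| + 1 by rewrite ltr_wpDl// addr_ge0.
have [C C0 CP] := bounded_on_ball q (Du v) r0.
have I0 : `](-1), 1[%classic (0 : R) by rewrite /= in_itv /= ltrN10 ltr01.
have df (s t : R) : is_derive s (1 : R) (f ^~ t)
    (t ^+ j.+1 * 'D_v u (ray q (y + s *: v) t)).
  exact: is_derive_weighted_ray.
have d1f (s t : R) : partial1of2 f s t = t ^+ j.+1 * 'D_v u (ray q (y + s *: v) t).
  by rewrite partial1of2E; have [_ ->] := df s t.
have intf (s : R) : `](-1), 1[%classic s ->
    (@lebesgue_measure R).-integrable `[0%R, 1%R] (EFin \o f s).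
  by move=> _; apply/integrable01/continuous_ray_weight.
have intG : (@lebesgue_measure R).-integrable `[0%R, 1%R] (EFin \o (fun=> C)).
  exact/integrable01/cst_continuous.
have derf (s t : R) : `](-1), 1[%classic s -> `[0%R, 1%R]%classic t ->
    derivable (f ^~ t) s 1.
  by move=> _ _; exact: (@ex_derive _ _ _ _ _ _ _ (df s t)).
have G_ub (s t : R) : `](-1), 1[%classic s -> `[0%R, 1%R]%classic t ->
    `|partial1of2 f s t| <= C.
  rewrite /= !in_itv /= d1f => /andP[s1 s2] /[dup] t01 /andP[t0 t1].
  rewrite normrM; apply: (@le_trans _ _ `|'D_v u (ray q (y + s *: v) t)|).
    by rewrite ler_piMl// normrX ger0_norm// exprn_ile1.
  apply: CP; apply: le_trans (ray_ball _ _ t01) _.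
  rewrite addrAC; apply: le_trans (ler_normD _ _) _.
  rewrite -addrA lerD2l normrZ; apply: (@le_trans _ _ `|v|).
    by rewrite ler_piMl// ler_norml ltW//= ltW.
  by rewrite lerDl.
split.
  exact: (@derivable_under_integral R _ _ (@lebesgue_measure R) f _
    (measurable_itv _) 0 (-1) 1 I0 intf derf (fun=> C) (fun=> C0) intG G_ub).
rewrite -derive1E.
have -> := @differentiation_under_integral R _ _ (@lebesgue_measure R) f _
  (measurable_itv _) 0 (-1) 1 I0 intf derf (fun=> C) (fun=> C0) intG G_ub.
apply: eq_Rintegral => t _.
by rewrite d1f scale0r addr0.
Qed.

Lemma smoothT_derivable u z v : smooth_on setT u -> derivable u z v.
Proof. by move=> /(_ 1%N) [_ [du _]]; exact: du. Qed.

Lemma smoothT_derive u v : smooth_on setT u -> smooth_on setT ('D_v u).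
Proof. by move=> su m; have [_ [_ Du]] := su m.+1; exact: Du. Qed.

Lemma smoothT_continuous u : smooth_on setT u -> continuous u.
Proof. by move=> su z; have [uc _] := su 0%N; exact: uc. Qed.

Lemma Ck_ray_int k j u q : smooth_on setT u -> Ck k setT (ray_int j u q).
Proof.
elim: k j u => [|k IH] j u su.
all: have du z v : derivable u z v by exact: smoothT_derivable.
all: have Du v : continuous ('D_v u) by exact/smoothT_continuous/smoothT_derive.
all: split; first by move=> z _; exact: continuous_ray_int.
- by [].
split=> [y v _|v].
  exact: (@ex_derive _ _ _ _ _ _ _ (is_derive_ray_int j q y v du Du)).
rewrite (_ : 'D_v _ = ray_int j.+1 ('D_v u) q).
  exact/IH/smoothT_derive.
by apply/funext => y; have [_ ->] := is_derive_ray_int j q y v du Du.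
Qed.

Lemma derive_coord u z v : smooth_on setT u ->
  'D_v u z = \sum_i v 0 i * 'D_'e_i u z.
Proof.
move=> su; have dc i :
    is_derive (0 : R) (1 : R) (fun t : R => (z + t *: v) 0 i) (v 0 i).
  have := is_deriveD (is_derive_cst (z 0 i) (0 : R) (1 : R))
    (is_deriveZ (v 0 i) (is_derive_id (0 : R) (1 : R))).
  rewrite add0r [v 0 i *: 1]mulr1; congr (is_derive _ _ _ _).
  by apply/funext => t; rewrite !mxE mulrC.
have := @is_derive_curve _ n u setT (fun t => z + t *: v) (v 0) openT I.
rewrite scale0r addr0 => /(_ (fun i y _ => smoothT_derivable su)).
move=> /(_ (fun i => @smoothT_continuous _ (smoothT_derive 'e_i su) z) dc) [_ <-].
by rewrite derive_line scale0r addr0.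
Qed.

Lemma hadamard u q : smooth_on setT u -> exists G : 'I_n -> 'rV[R]_n -> R,
  [/\ forall i, smooth_on setT (G i), forall i, G i q = 'D_'e_i u q &
      forall y, u y = u q + \sum_i (y 0 i - q 0 i) * G i y].
Proof.
move=> su; have sD v := smoothT_derive v su.
have dD v z v' := @smoothT_derivable _ z v' (sD v).
(* The mean of each partial derivative over the segment from [q] to [y]. *)
exists (fun i => ray_int 0 ('D_'e_i u) q); split.
- by move=> i m; exact: Ck_ray_int.
- move=> i; rewrite /ray_int (_ : (fun _ => _) = (fun=> 'D_'e_i u q)).
    exact: int01_cst.
  by apply/funext => t; rewrite expr0 mul1r /ray subrr scaler0 addr0.
move=> y; have dF (t : R) : is_derive t (1 : R) (fun t : R => u (ray q y t))
    ('D_(y - q) u (ray q y t)).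
  by rewrite -derive_line; apply/derivableP/derivable_line/smoothT_derivable.
have := int01_derive (continuous_ray (dD (y - q))) dF.
rewrite /ray scale1r scale0r addr0 subrKC => e.
rewrite -[LHS](subrKC (u q)) -e; congr (_ + _).
transitivity (int01 (fun t => \sum_i (y 0 i - q 0 i) * 'D_'e_i u (ray q y t))).
  congr int01; apply/funext => t; rewrite derive_coord//.
  by apply: eq_bigr => i _; rewrite !mxE.
rewrite int01_sum; last first.
  move=> i t; apply: cvgM; first exact: cvg_cst.
  exact: (continuous_ray (dD 'e_i)).
apply: eq_bigr => i _; rewrite int01Zl; last exact: (continuous_ray (dD 'e_i)).
by rewrite /ray_int; congr (_ * int01 _); apply/funext => t; rewrite expr0 mul1r.
Qed.

End HadamardLemma.

(** * Vector fields in a chart *)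

Section LocalFrame.
Context {R : realType} {d : nat} {M : manifold R d}.
Local Notation C := (smooth_fun M).
Context (k : chart R d M) (b : 'rV[R]_d -> R) (K : set 'rV[R]_d).
Hypothesis atlas_k : atlas k.
Hypothesis smooth_b : smooth_on setT b.
Hypothesis compact_K : compact K.
Hypothesis K_img : K `<=` chart_img k.
Hypothesis b0 : forall y, ~ K y -> b y = 0.
Implicit Types (f h : C) (u : 'rV[R]_d -> R) (X : vfield M).

Lemma bump_ext_smooth u : smooth_on (chart_img k) u ->
  ext0 k (b * u) \in smooth_pred (M := M).
Proof.
move=> su; apply: (ext0_smooth atlas_k compact_K K_img) => [m|y nKy].
  apply: Ck_mul; [exact: chart_img_open| |exact: su].
  exact: Ck_sub (smooth_b m).
by rewrite -[LHS]/(b y * u y) b0// mul0r.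
Qed.

Definition bump_ext u (su : smooth_on (chart_img k) u) : C :=
  SmoothFun (bump_ext_smooth su).

Lemma bump_ext_dom u (su : smooth_on (chart_img k) u) x : chart_dom k x ->
  bump_ext su x = b (chart_map k x) * u (chart_map k x).
Proof. exact: ext0_dom. Qed.

Lemma bump_ext_Ndom u (su : smooth_on (chart_img k) u) x : ~ chart_dom k x ->
  bump_ext su x = 0.
Proof. exact: ext0_Ndom. Qed.

Lemma chart_smooth f : smooth_on (chart_img k) (f \o chart_inv k).
Proof. by have /asboolP/(_ _ atlas_k) := valP f. Qed.

Lemma chart_derive_smooth f v : smooth_on (chart_img k) ('D_v (f \o chart_inv k)).
Proof. by move=> m; have [_ [_ Df]] := chart_smooth f m.+1; exact: Df. Qed.

Lemma chart_derivable f y v : chart_img k y -> derivable (f \o chart_inv k) y v.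
Proof. by have [_ [df _]] := chart_smooth f 1; exact: df. Qed.

(** The coordinate field is defined only on the chart domain; multiplied by [b] it extends by zero
    to a global derivation. *)
Definition frame_fun (i : 'I_d) (f : C) : C^o :=
  bump_ext (chart_derive_smooth f 'e_i).

Lemma frame_fun_derivation i : frame_fun i \in derivation_pred (M := M).
Proof.
apply/asboolP; split=> [r f h|f h]; apply: sfunP => x.
  have [xk|xNk] := pselect (chart_dom k x); last first.
    by rewrite !sfunE !bump_ext_Ndom// mulr0 addr0.
  have [yk _] := chart_mapK xk.
  rewrite !sfunE !bump_ext_dom// mulrCA -mulrDr; congr (_ * _).
  rewrite (_ : _ \o _ = r *: (f \o chart_inv k) + (h \o chart_inv k))//.
  have df := @chart_derivable f _ 'e_i yk; have dh := @chart_derivable h _ 'e_i yk.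
  by rewrite deriveD ?deriveZ//; exact: derivableZ.
have [xk|xNk] := pselect (chart_dom k x); last first.
  by rewrite !sfunE !bump_ext_Ndom// mul0r mulr0 addr0.
have [yk fx] := chart_mapK xk.
have df := @chart_derivable f _ 'e_i yk; have dh := @chart_derivable h _ 'e_i yk.
rewrite !sfunE !bump_ext_dom//.
rewrite (_ : _ \o _ = (f \o chart_inv k) * (h \o chart_inv k))// deriveM//=.
by rewrite fx -![_ *: _]/(_ * _); ring.
Qed.

Definition frame i : vfield M := VField (frame_fun_derivation i).

Lemma smooth_cst1 (U : set 'rV[R]_d) : smooth_on U (cst 1 : 'rV[R]_d -> R).
Proof. by move=> m; exact: Ck_cst. Qed.

Lemma smooth_coord (U : set 'rV[R]_d) i :
  smooth_on U (fun y : 'rV[R]_d => y 0 i).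
Proof. by move=> m; exact: Ck_id. Qed.

Definition bump_fun : C := bump_ext (@smooth_cst1 _).
Definition coord_fun i : C := bump_ext (@smooth_coord _ i).

Lemma bump_fun_dom x : chart_dom k x -> bump_fun x = b (chart_map k x).
Proof. by move=> xk; rewrite bump_ext_dom// mulr1. Qed.

Lemma coord_fun_dom i x : chart_dom k x ->
  coord_fun i x = b (chart_map k x) * chart_map k x 0 i.
Proof. exact: bump_ext_dom. Qed.

Lemma lieder_sum X (I : Type) (r : seq I) (F : I -> C) :
  lieder X (\sum_(i <- r) F i) = \sum_(i <- r) lieder X (F i).
Proof.
elim: r => [|i r IH]; first by rewrite !big_nil lieder0.
by rewrite !big_cons liederD IH.
Qed.

(* At a point [x] of the support, subtract [f x] from [f], apply the Hadamard
   lemma at the coordinates of [x] and differentiate the product; the fourth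
   power of the bump function clears all the denominators. *)
Lemma frame_decomposition X :
  (bump_fun * bump_fun * bump_fun * bump_fun) *: X =
  \sum_i ((bump_fun * lieder X (coord_fun i) - coord_fun i * lieder X bump_fun)
          * bump_fun) *: frame i.
Proof.
apply: vfieldP => f; apply: sfunP => x; rewrite liederZl.
have lsum (r : seq 'I_d) (F : 'I_d -> vfield M) :
    lieder (\sum_(i <- r) F i) f x = \sum_(i <- r) lieder (F i) f x.
  elim: r => [|i r IH]; first by rewrite !big_nil.
  by rewrite !big_cons -IH.
rewrite lsum; set rho := bump_fun.
have [rx0|rx0] := eqVneq (rho x) 0.
  rewrite !sfunE rx0 !mulr0 !mul0r big1// => i _.
  by rewrite liederZl !sfunE rx0 mulr0 mul0r.
have [xk|xNk] := pselect (chart_dom k x); last first.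
  by move: rx0; rewrite /rho bump_ext_Ndom// eqxx.
have [yk ix] := chart_mapK xk; set q := chart_map k x in yk ix *.
have rxq : rho x = b q by rewrite /rho bump_ext_dom// mulr1.
pose h := f - smooth_cst M (f x).
have hx : h x = 0 by rewrite /h !sfunE subrr.
have sF : smooth_on setT (b * (h \o chart_inv k)).
  apply: (smooth_bump_mul smooth_b b0 _ _ K_img (chart_smooth h)).
    exact: compact_closed.
  exact: chart_img_open.
have [G [sG Gq GE]] := hadamard q sF.
have sGk i : smooth_on (chart_img k) (G i).
  by move=> m; apply: Ck_sub (sG i m).
pose Gam i : C := bump_ext (sGk i).
(* One [rho] makes the Hadamard lemma applicable to [h], one cuts off the coordinate differences,
   and one cuts off the [G i]. *)
have key : rho * rho * rho * h =
    \sum_i (coord_fun i - smooth_cst M (q 0 i) * rho) * Gam i.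
  apply: sfunP => z; rewrite sfun_sum.
  have [zk|zNk] := pselect (chart_dom k z); last first.
    rewrite !sfunE {1}/rho bump_ext_Ndom// !mul0r big1// => i _.
    by rewrite !sfunE [Gam i z]bump_ext_Ndom// mulr0.
  have [zi iz] := chart_mapK zk.
  have := GE (chart_map k z).
  rewrite -[(b * _) _]/(b (chart_map k z) * h (chart_inv k (chart_map k z))).
  rewrite -[(b * _) q]/(b q * h (chart_inv k q)) ix hx mulr0 add0r iz => e.
  rewrite !sfunE bump_fun_dom// -mulrA e mulr_sumr.
  apply: eq_bigr => i _.
  rewrite !sfunE coord_fun_dom// bump_fun_dom// [Gam i z]bump_ext_dom//; ring.
have := congr1 (fun F : C => lieder X F x) key.
rewrite lieder_sum sfun_sum liederM sfunD !sfunM hx mulr0 add0r.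
have -> : lieder X h = lieder X f by rewrite liederD liederN lieder_cst subr0.
move=> e; transitivity (rho x * (rho x * rho x * rho x * lieder X f x)).
  by ring.
rewrite e mulr_sumr; apply: eq_bigr => i _.
have cx : coord_fun i x = b q * q 0 i by rewrite bump_ext_dom.
have hD : 'D_'e_i (h \o chart_inv k) q = 'D_'e_i (f \o chart_inv k) q.
  rewrite (_ : h \o _ = (f \o chart_inv k) + cst (- f x))//.
  by rewrite deriveD ?derive_cst ?addr0//; exact: chart_derivable.
(* Since [h] vanishes at [x], the derivative of [b h] at [q] is [b q] times that of [h]. *)
have gx : Gam i x = rho x * (frame_fun i f : C) x.
  rewrite !bump_ext_dom// -/q Gq deriveM; last first.
  - exact: chart_derivable.
  - exact: smoothT_derivable.
  rewrite -[(h \o _) q]/(h (chart_inv k q)) ix hx scale0r addr0 hD.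
  by rewrite [X in _ = X * _]mulr1.
rewrite liederM liederD liederN liederM lieder_cst mul0r add0r liederZl.
rewrite !sfunE gx cx -rxq; rewrite -/(frame_fun i f : C).
have -> : lieder (frame i) f x = (frame_fun i f : C) x by [].
ring.
Qed.

End LocalFrame.

(** Each coefficient of the frame decomposition is linear in derivatives along [X], hence vanishes
    at [p], while the bump function does not. *)
Lemma same_at0_vanishes (R : realType) (d : nat) (M : manifold R d) p
  (X : vfield M) : same_at p X 0 -> vanishes p X.
Proof.
move=> X0; have [k ak pk] := atlas_cover p; have [yk _] := chart_mapK pk.
have [b [K [sb bp cK KU b0]]] := bump_exists (@chart_img_open _ _ _ k) yk.
have X0' (f : smooth_fun M) : lieder X f p = 0 by exact: X0.
have dec := frame_decomposition ak sb cK KU b0 X.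
set rho := bump_fun _ _ _ _ _ in dec.
have rp : rho p != 0 by rewrite /rho bump_ext_dom// mulr1.
move=> L hL; have : vanishes p ((rho * rho * rho * rho) *: X).
  rewrite dec; elim/big_ind: _ => [|U V U0 V0|i _].
  - by rewrite -(scale0r 0); exact: vanishesZ.
  - exact: vanishesD.
  - by apply: vanishesZ; rewrite !sfunE !X0' !mulr0 subrr mul0r.
have L0 : L 0 = 0.
  by have := hL (-1) 0 0; rewrite scaler0 addr0 mulN1r addNr.
move=> /(_ L hL); rewrite -[_ *: X]addr0 hL L0 addr0 !sfunM => /eqP.
by rewrite !mulf_eq0 !(negPf rp) /= => /eqP.
Qed.

Theorem theorem3p8 (R : realType) (n l : nat) (M : manifold R (4 * n + 3))
    (g : metric M) (phi : 'I_3 -> endo M) (xi : 'I_3 -> vfield M)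
    (eta : 'I_3 -> one_form M) (nabla : vfield M -> vfield M -> vfield M)
    (c : R)
    (h3qs : three_quasi_sasakian g phi xi eta)
    (hrank : forall a, has_rank (eta a) (4 * l + 3))
    (hc : for_even_perms (fun a b k =>
       lie_bracket (xi a) (xi b) = smooth_cst M c *: xi k))
    (hnabla : levi_civita g nabla) :
  let H a X : smooth_fun M := phi_sectional_curvature g nabla (phi a) X in
  let sumH X (p : M) : R := \sum_a H a X p in
  let E4l := dist_E4l g xi eta in
  let E4m := dist_E4m eta in
  forall (U : set M) (X : vfield M), open U ->
    (forall p, U p -> g X X p = 1) ->
    [/\ section_on U (horizontal eta) X -> forall p, U p ->
          sumH X p =
          3 * c ^+ 2 / 4 * g (orth_proj g E4l X) (orth_proj g E4l X) p ^+ 2,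
        section_on U E4l X -> forall p, U p -> sumH X p = 3 * c ^+ 2 / 4 &
        section_on U E4m X -> forall p, U p -> sumH X p = 0].
Proof.
move=> H sumH E4l E4m U X oU X1.
have qs i : quasi_sasakian g (phi i) (xi i) (eta i) by case: h3qs.
have S p : horizontal eta p X -> sumH X p = _ :=
  @sum_phi_sectional_at _ _ _ _ _ hnabla _ _ _ h3qs X p.
have hX' := hor_hpart h3qs X.
have same p (Y : vfield M) : same_at p Y 0 -> vanishes p Y :=
  @same_at0_vanishes _ _ _ p Y.
split=> hX p Up.
- rewrite S; last exact: hX.
  (* For [c = 0] both sides are zero, whatever the projection is. *)
  have [c0|c0] := eqVneq c 0.
    rewrite (vorticity_phi_c0 hnabla h3qs hc c0 hX') c0 sfun0.
    ring.
  (* For the horizontal part, [|E4l_part X|^2 = (2/c)^2 |A X|^2 = -(2/c) a(X, X)]. *)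
  rewrite (orth_proj_E4l hnabla h3qs hc same X c0) /E4l_part metricZl metricZr.
  by rewrite (metric_shape_shape hnabla h3qs hc)// !sfunE; field.
- have hXp := hX p Up; rewrite S; last exact: (E4lP h3qs hXp).1.
  have [c0|c0] := eqVneq c 0.
    rewrite (vorticity_phi_c0 hnabla h3qs hc c0 hX') c0 sfun0.
    ring.
  rewrite (E4l_vorticity_phi hnabla h3qs hc c0 hXp (X1 p Up)).
  by field.
- have hXp := hX p Up; rewrite S; last exact: hXp.1.
  (* It is enough to move one argument of [a] back from the horizontal part to [X], which lies in
     [E^4m] at [p]. *)
  rewrite -(shapeE (qs _)) metricC.
  rewrite -(metric_hpart (xi := xi) (eta := eta)); last exact: hXp.1.
  rewrite metricC (shapeE (qs _)) (vorticity_phi_sym hnabla (qs _)).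
  by rewrite (E4m_vorticity_phi hnabla h3qs _ hXp); ring.
Qed.
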